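(* Let $N=2n+1\ge 3$ be an odd integer and let $f\in U_N(\mathbb{Z})$ be a binary $N$-ic form with nonzero discriminant. For each prime $p$, choose $(A_p,B_p)\in \mathrm{inv}^{-1}(f)\cap W_N^0(\mathbb{Z}_p)$. Then there exists $(A,B)\in W_N^0(\mathbb{Z})$, unique up to the action of $G_N(\mathbb{Z})$, such that $(A,B)$ is $G_N(\mathbb{Z}_p)$-equivalent to $(A_p,B_p)$ for each prime $p$.
   Context: For a commutative ring $R$: $U_N(R)$ is the set of binary forms of degree $N$ over $R$; $W_N(R)$ is the set of pairs $(A,B)$ of symmetric $N\times N$ matrices over $R$; $\mathrm{inv}\colon W_N(R)\to U_N(R)$ is $\mathrm{inv}(A,B)=(-1)^n\det(xA-yB)$. The group $\mathrm{SL}_N(R)$ acts on $W_N(R)$ by $g\cdot(A,B)=(gAg^T,gBg^T)$. Let $W_N^0(R)=\{(A,B)\in W_N(R): A_{ij}=B_{ij}=0\text{ if } i,j\le n\}$ and $G_N(R)=\{g\in\mathrm{SL}_N(R): g_{ij}=0\text{ for all } i\le n,\ j\ge n+1\}$; the $\mathrm{SL}_N$-action restricts to an action of $G_N(R)$ on $W_N^0(R)$. *)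

(* Defs.v *)
From HB Require Import structures.
From mathcomp Require Import all_boot all_order all_algebra.
From mathcomp Require Import boolp.
From mathcomp Require Import mpoly.

Set Implicit Arguments.
Unset Strict Implicit.
Unset Printing Implicit Defensive.
Import GRing.Theory.
Local Open Scope ring_scope.

(* Z_p as the inverse limit of the rings Z/p^(k+1), k >= 0, along reduction.
   If p <= 1, then 'Z_(p ^ k.+1) denotes Z/2 and the type is still a ring, but
   an irrelevant one; only prime p are meaningful. *)
Section Padic.
Variable p : nat.

Record padic := Padic {
  padic_val :> forall k : nat, 'Z_(p ^ k.+1);
  _ : `[< forall k, inZp (padic_val k.+1) = padic_val k >] }.

HB.instance Definition _ := [isSub for padic_val].
HB.instance Definition _ := [Choice of padic by <:].

Lemma padic_coh (x : padic) k : inZp (x k.+1) = x k.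
Proof. by case: x => x /= /asboolP. Qed.

Lemma padicP (x y : padic) : (forall k, x k = y k) -> x = y.
Proof. by move=> e; apply/val_inj/functional_extensionality_dep. Qed.

Lemma Zp_trunc_dvd k :
  ((Zp_trunc (p ^ k.+1)).+2 %| (Zp_trunc (p ^ k.+2)).+2)%N.
Proof.
case: p => [|[|q]]; rewrite ?exp0n ?exp1n // !Zp_cast ?dvdn_exp2l //;
  by rewrite -[1%N](expn0 q.+2) ltn_exp2l.
Qed.

Lemma inZp_red k (m : nat) :
  (inZp (m %% (Zp_trunc (p ^ k.+2)).+2) : 'Z_(p ^ k.+1)) = inZp m.
Proof. by apply/val_inj; rewrite /= modn_dvdm ?Zp_trunc_dvd. Qed.

Lemma inZp_add k (a b : 'Z_(p ^ k.+2)) :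
  (inZp (a + b)%R : 'Z_(p ^ k.+1)) = inZp a + inZp b.
Proof. by rewrite inZp_red; apply/val_inj; rewrite /= modnDm. Qed.

Fact padic_zero_coh :
  `[< forall k, inZp (0%R : 'Z_(p ^ k.+2)) = 0 :> 'Z_(p ^ k.+1) >].
Proof. by apply/asboolP=> k; apply/val_inj; rewrite /= mod0n. Qed.
Definition padic_zero := Padic padic_zero_coh.

Fact padic_one_coh :
  `[< forall k, inZp (1%R : 'Z_(p ^ k.+2)) = 1 :> 'Z_(p ^ k.+1) >].
Proof. by apply/asboolP=> k; rewrite inZp_red; apply/val_inj. Qed.
Definition padic_one := Padic padic_one_coh.

Fact padic_opp_coh (x : padic) :
  `[< forall k, inZp (- x k.+1)%R = - x k >].
Proof.
apply/asboolP=> k; apply/eqP; rewrite -addr_eq0 -[X in _ + X]padic_coh.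
by rewrite -inZp_add addNr; apply/eqP/val_inj; rewrite /= mod0n.
Qed.
Definition padic_opp x := Padic (padic_opp_coh x).

Fact padic_add_coh (x y : padic) :
  `[< forall k, inZp (x k.+1 + y k.+1)%R = x k + y k >].
Proof.
apply/asboolP=> k; rewrite -!(padic_coh _ k).
exact: inZp_add.
Qed.
Definition padic_add x y := Padic (padic_add_coh x y).

Fact padic_mul_coh (x y : padic) :
  `[< forall k, inZp (x k.+1 * y k.+1)%R = x k * y k >].
Proof.
apply/asboolP=> k; rewrite -!(padic_coh _ k) inZp_red.
by apply/val_inj; rewrite /= modnMm.
Qed.
Definition padic_mul x y := Padic (padic_mul_coh x y).

Fact padic_addA : associative padic_add.
Proof. by move=> x y z; apply: padicP => k; apply: addrA. Qed.
Fact padic_addC : commutative padic_add.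
Proof. by move=> x y; apply: padicP => k; apply: addrC. Qed.
Fact padic_add0 : left_id padic_zero padic_add.
Proof. by move=> x; apply: padicP => k; apply: add0r. Qed.
Fact padic_addN : left_inverse padic_zero padic_opp padic_add.
Proof. by move=> x; apply: padicP => k; apply: addNr. Qed.

HB.instance Definition _ := GRing.isZmodule.Build padic
  padic_addA padic_addC padic_add0 padic_addN.

Fact padic_mulA : associative padic_mul.
Proof. by move=> x y z; apply: padicP => k; apply: mulrA. Qed.
Fact padic_mulC : commutative padic_mul.
Proof. by move=> x y; apply: padicP => k; apply: mulrC. Qed.
Fact padic_mul1 : left_id padic_one padic_mul.
Proof. by move=> x; apply: padicP => k; apply: mul1r. Qed.
Fact padic_mulD : left_distributive padic_mul +%R.
Proof. by move=> x y z; apply: padicP => k; apply: mulrDl. Qed.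
Fact padic_1neq0 : padic_one != 0.
Proof.
apply/eqP=> /(congr1 (fun x : padic => x 0%N)) /eqP; apply/negP.
exact: oner_neq0.
Qed.

HB.instance Definition _ := GRing.Zmodule_isComNzRing.Build padic
  padic_mulA padic_mulC padic_mul1 padic_mulD padic_1neq0.

End Padic.

Section BinaryForms.
Variable R : comNzRingType.

Definition varx : {mpoly R[2]} := 'X_(0 : 'I_2).
Definition vary : {mpoly R[2]} := 'X_(1 : 'I_2).

Definition binary_form (N : nat) (f : {mpoly R[2]}) : Prop := f \is N.-homog.

(* The coefficient of x^(d-i) y^i. *)
Definition form_coef (d : nat) (f : {mpoly R[2]}) (i : nat) : R :=
  f@_(U_(0%R : 'I_2) *+ (d - i) + U_(1%R : 'I_2) *+ i)%MM.

(* The resultant of two binary forms of degree d, as the determinant of their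
   Sylvester matrix. Its size depends on d only, so, unlike [resultant] on
   {poly R}, it does not change when leading coefficients vanish. *)
Definition sylvester_rows (d : nat) (f : {mpoly R[2]}) : 'M[R]_(d, d + d) :=
  \matrix_(i < d, j < d + d)
    (if (i <= j <= i + d)%N then form_coef d f (j - i) else 0).

Definition form_resultant (d : nat) (f g : {mpoly R[2]}) : R :=
  \det (col_mx (sylvester_rows d f) (sylvester_rows d g)).

End BinaryForms.

Arguments varx {R}.
Arguments vary {R}.

(* The discriminant of a binary form f of degree N >= 2 over Z, normalized by
   N^(N-2) disc f = (-1)^(N(N-1)/2) Res(df/dx, df/dy): for N = 2 it is
   b^2 - 4ac, and if f = prod_i (a_i x - b_i y) over an algebraic closure, it
   is prod_(i < j) (a_i b_j - a_j b_i)^2. *)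
Definition form_disc (N : nat) (f : {mpoly int[2]}) : rat :=
  (-1) ^+ 'C(N, 2)
  * (form_resultant N.-1 (mderiv 0 f) (mderiv 1 f))%:~R / N%:R ^+ (N - 2).

Section Pairs.
Variables (R : comNzRingType) (n : nat).

Notation N := n.*2.+1.

Definition inW (AB : 'M[R]_N * 'M[R]_N) : Prop :=
  AB.1^T = AB.1 /\ AB.2^T = AB.2.

(* Indices start at 0, so that i, j <= n becomes i, j < n. *)
Definition inW0 (AB : 'M[R]_N * 'M[R]_N) : Prop :=
  inW AB /\
  forall i j : 'I_N, (i < n)%N -> (j < n)%N -> AB.1 i j = 0 /\ AB.2 i j = 0.

Definition inv_form (AB : 'M[R]_N * 'M[R]_N) : {mpoly R[2]} :=
  (-1) ^+ n * \det (varx *: map_mx (@mpolyC 2 R) AB.1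
                    - vary *: map_mx (@mpolyC 2 R) AB.2).

Definition inSL (g : 'M[R]_N) : Prop := \det g = 1.

Definition inG (g : 'M[R]_N) : Prop :=
  inSL g /\ forall i j : 'I_N, (i < n)%N -> (n <= j)%N -> g i j = 0.

Definition act (g : 'M[R]_N) (AB : 'M[R]_N * 'M[R]_N) : 'M[R]_N * 'M[R]_N :=
  (g *m AB.1 *m g^T, g *m AB.2 *m g^T).

Definition G_equiv (AB CD : 'M[R]_N * 'M[R]_N) : Prop :=
  exists g : 'M[R]_N, inG g /\ act g AB = CD.

End Pairs.

Definition form_of_int (R : comNzRingType) (f : {mpoly int[2]}) : {mpoly R[2]} :=
  map_mpoly (intr : int -> R) f.

Definition pair_of_int (R : comNzRingType) (n : nat)
    (AB : 'M[int]_(n.*2.+1) * 'M[int]_(n.*2.+1)) :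
    'M[R]_(n.*2.+1) * 'M[R]_(n.*2.+1) :=
  (map_mx (intr : int -> R) AB.1, map_mx (intr : int -> R) AB.2).

(* Main.v *)
Require Import Defs.
From HB Require Import structures.
From mathcomp Require Import all_boot all_order all_algebra.
From mathcomp Require Import boolp.
From mathcomp Require Import mpoly zify ring.

Set Implicit Arguments.
Unset Strict Implicit.
Unset Printing Implicit Defensive.
Import GRing.Theory.
Local Open Scope ring_scope.
(** The pair (A, B) has off-diagonal blocks (A1, B1), of size n x (n+1), and
    diagonal blocks (A2, B2).  Put x = 1, y = X.  The pencil A1 - X B1 is killed
    by the vector v of its maximal minors, which are polynomials of degree n;
    let V be the square matrix of their coefficients, so that v = V *m powers
    with powers = (1, X, ..., X^n).  The rows of (A1 - X B1) *m V are linear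
    syzygies of the powers, hence (A1 - X B1) *m V = g *m (rpad - X lpad) for a
    matrix g, and det g = det V ([normal_form]).  Moreover the form is
    f = v^T (A2 - X B2) v ([det_bordered]), which prescribes the value on the
    powers of the symmetric pencil S with blocks V^T A2 V and V^T B2 V.  Two
    such S differ by the symmetrization of W *m (rpad - X lpad) for a unique
    matrix W, over any commutative ring ([symmetric_pencil_sol],
    [symmetric_pencil_sol0]).  So, relative to one fixed S, the pair (A, B) is
    encoded by (g, V, W).  An element of G with diagonal blocks k1, k2 and lower
    left block w replaces g by k1 *m g and V by the inverse transpose of k2
    times V, and changes W by V'^T *m w *m g where V' is the new V
    ([minors_mx_equiv], [quad_equiv]).

    Since f is quadratic in v, both partial derivatives of f lie in the ideal
    generated by the entries of v.  If the resultant of the partial derivatives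
    is invertible, that ideal contains all forms of degree 4n - 1, and a descent
    on the degree, based on the fact that the rows of the pencil generate the
    syzygies of v, shows that v spans the forms of degree n.  Keeping track of
    denominators, det V divides a power of the resultant
    ([resultant_minors_mx]).  Therefore det V is never zero, and it is a p-adic
    unit for almost all p.

    Uniqueness: the blocks k1, k2, w of a local equivalence of two integral
    pairs are the only solutions of linear equations with integer coefficients,
    namely those that express the change of g, V and W, so they are integral
    and independent of p ([block_equiv_local_global]).

    Existence: this is the statement that G has class number one.  The rows of
    the local matrices g and V span lattices which come from global ones; their
    integer bases have equal determinants ([local_lattice_pair]).  The unipotent
    part is strong approximation for W, by the Chinese remainder theorem.  The
    resulting pair is integral because it is so at every prime
    ([block_exists]). *)

(** * p-adic integers: approximation and torsion-freeness *)

Section PadicTheory.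
Variable p : nat.
Hypothesis p_pr : prime p.

Lemma expp_gt1 k : (1 < p ^ k.+1)%N.
Proof. by rewrite -[1%N](expn0 p) ltn_exp2l // prime_gt1. Qed.

Lemma val_padic_coh (x : padic p) k : (x k.+1 : nat) = x k %[mod p ^ k.+1].
Proof.
move/(congr1 val): (padic_coh x k) => /= <-.
by rewrite [X in (_ = _ %% X %[mod _])%N]Zp_cast ?expp_gt1 // modn_mod.
Qed.

Lemma padic_mod (x : padic p) j k :
  (j <= k)%N -> (x k : nat) = x j %[mod p ^ j.+1].
Proof.
elim: k => [|k IHk]; first by rewrite leqn0 => /eqP->.
rewrite leq_eqVlt => /predU1P[-> //|le_jk].
rewrite -IHk //; apply/eqP.
rewrite -(@modn_dvdm (p ^ k.+1)) ?dvdn_exp2l // val_padic_coh.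
by rewrite modn_dvdm ?dvdn_exp2l.
Qed.

Lemma padic_ltn (x : padic p) k : (x k < p ^ k.+1)%N.
Proof. by have := ltn_ord (x k); rewrite [X in (_ < X)%N]Zp_cast ?expp_gt1. Qed.

Lemma padic_natE m k : (m%:R : padic p) k = (m %% p ^ k.+1)%N :> nat.
Proof.
rewrite -val_Zp_nat ?expp_gt1 //; congr (nat_of_ord _).
by elim: m => // m IHm; rewrite -![m.+1%:R]natr1 -IHm.
Qed.

Lemma padic_eq_mod (x y : padic p) :
  (forall k, (x k : nat) = y k %[mod p ^ k.+1]) -> x = y.
Proof.
move=> xy; apply: padicP => k; apply: val_inj.
by move: (xy k); rewrite /= !modn_small ?padic_ltn.
Qed.

Lemma padic_mulE (x y : padic p) k : (x * y) k = (x k * y k %% p ^ k.+1)%N :> nat.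
Proof. by rewrite /= [X in (_ %% X)%N]Zp_cast ?expp_gt1. Qed.

Lemma padic_addE (x y : padic p) k : (x + y) k = ((x k + y k) %% p ^ k.+1)%N :> nat.
Proof. by rewrite /= [X in (_ %% X)%N]Zp_cast ?expp_gt1. Qed.

Lemma padic_of_nat (u : nat -> nat) :
    (forall k, u k.+1 = u k %[mod p ^ k.+1]) ->
  exists x : padic p, forall k, (x k : nat) = (u k %% p ^ k.+1)%N.
Proof.
move=> u_coh; pose x k : 'Z_(p ^ k.+1) := inZp (u k).
have x_coh : `[< forall k, inZp (x k.+1) = x k >].
  apply/asboolP => k; apply: val_inj => /=.
  rewrite !Zp_cast ?expp_gt1 // modn_dvdm ?dvdn_exp2l //; exact: u_coh.
exists (Padic x_coh) => k /=; rewrite [X in (_ %% X)%N]Zp_cast ?expp_gt1 //.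
Qed.

(** The quotient is read off the coordinates of x, shifted by k. *)
Lemma padic_approx (x : padic p) k :
  exists (a : nat) (y : padic p), x = a%:R + (p ^ k)%:R * y.
Proof.
(* The digits are forgotten to live in Z/p^(j+1), which depends on j. *)
have [u uE] : exists u : nat -> nat, forall j, u j = x j.
  by exists (fun j => nat_of_ord (x j)).
have u_mod i j : (i <= j)%N -> (u j = u i %[mod p ^ i.+1])%N.
  by move=> le_ij; rewrite !uE; apply: padic_mod.
have u_mod' i j : (i <= j)%N -> (u j = u i %[mod p ^ i])%N.
  have di : (p ^ i %| p ^ i.+1)%N by rewrite dvdn_exp2l.
  by move=> /u_mod e; rewrite -(modn_dvdm (u j) di) e modn_dvdm.
have [|y yE] := @padic_of_nat (fun j => u (j + k)%N %/ p ^ k)%N.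
  move=> j; rewrite !modn_divl -expnD [in RHS]addSn; congr (_ %/ _)%N.
  by apply: u_mod; rewrite addSn.
exists (u k %% p ^ k)%N, y; apply: padic_eq_mod => j.
rewrite padic_addE padic_mulE !padic_natE yE modn_mod.
rewrite modnDm -modnDmr modnMm modnDmr.
rewrite -(u_mod' _ _ (leq_addl j k)) addnC mulnC -divn_eq.
by rewrite -uE -(u_mod j (j + k)%N) ?leq_addr.
Qed.

Lemma padic_dvd_nat k m (y : padic p) :
  (p ^ k)%:R * y = m%:R -> (p ^ k %| m)%N.
Proof.
move=> pym.
have: nat_of_ord (((p ^ k)%:R * y : padic p) k) = (m%:R : padic p) k.
  by rewrite pym.
rewrite padic_mulE !padic_natE modnMml => e.
have dk : (p ^ k %| p ^ k.+1)%N by rewrite dvdn_exp2l.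
rewrite /dvdn -(@modn_dvdm (p ^ k.+1)) //.
by rewrite -e modn_dvdm // modnMr.
Qed.

Lemma padic_coprime_unit m : coprime m p -> exists y : padic p, m%:R * y = 1.
Proof.
move=> mp.
have m_u k : (m%:R : 'Z_(p ^ k.+1)) \is a GRing.unit.
  by rewrite unitZpE ?expp_gt1 // coprime_pexpl // coprime_sym.
pose u k := val ((m%:R : 'Z_(p ^ k.+1))^-1).
have mu k : (m * u k = 1 %[mod p ^ k.+1])%N.
  have: ((m * u k)%N%:R : 'Z_(p ^ k.+1)) = 1%:R.
    by rewrite natrM natr_Zp mulrV ?m_u.
  by move/(congr1 (@nat_of_ord _)); rewrite !val_Zp_nat ?expp_gt1.
have [|y yE] := @padic_of_nat u.
  move=> k; have mu1 : (m * u k.+1 = 1 %[mod p ^ k.+1])%N.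
    rewrite -(@modn_dvdm (p ^ k.+2) (m * _)) ?dvdn_exp2l // mu.
    by rewrite modn_dvdm ?dvdn_exp2l.
  rewrite -[u k.+1]muln1 -modnMmr -(mu k) modnMmr mulnCA mulnA -modnMml mu1.
  by rewrite modnMml mul1n.
exists y; apply: padic_eq_mod => k.
rewrite padic_mulE padic_natE yE modnMm modn_mod mu.
by rewrite -[1]/(1%:R) padic_natE modn_mod.
Qed.

Lemma padic_expp_dvd0 (x : padic p) :
  (forall k, exists y, x = (p ^ k)%:R * y) -> x = 0.
Proof.
move=> dvd_x; apply: padic_eq_mod => k; have [y ->] := dvd_x k.+1.
by rewrite padic_mulE -[0]/(0%:R) !padic_natE modnn mul0n mod0n.
Qed.

Lemma padic_expp_eq0 k (x : padic p) : (p ^ k)%:R * x = 0 -> x = 0.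
Proof.
move=> px0; apply: padic_expp_dvd0 => j.
have [a [y xE]] := padic_approx x j.
have /dvdnP[b ab] : (p ^ j %| a)%N.
  rewrite -(@dvdn_pmul2l (p ^ k)) ?expn_gt0 ?prime_gt0 // -expnD.
  apply: (@padic_dvd_nat _ _ (- y)); rewrite expnD !natrM.
  by apply/eqP; rewrite mulrN eq_sym -addr_eq0 -mulrA -mulrDr -xE px0.
by exists (b%:R + y); rewrite mulrDr xE ab natrM mulrC.
Qed.

Lemma padic_natr_eq0 m (x : padic p) : (0 < m)%N -> m%:R * x = 0 -> x = 0.
Proof.
move=> m_gt0; have [m' co_m' ->] := pfactor_coprime p_pr m_gt0.
have [y my] : exists y : padic p, m'%:R * y = 1.
  by apply: padic_coprime_unit; rewrite coprime_sym.
rewrite natrM -mulrA mulrCA => /padic_expp_eq0 m'x0.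
by rewrite -[x]mul1r -my mulrAC m'x0 mul0r.
Qed.

(** Identities between p-adic integers are cancelled below only by elements
    that divide an integer, so torsion-freeness replaces the fact that the
    p-adic integers form a domain. *)
Lemma padic_intr_lreg (m : int) : m != 0 -> GRing.lreg (m%:~R : padic p).
Proof.
move=> m_neq0 x y /eqP; rewrite -subr_eq0 -mulrBr => /eqP mxy0.
apply/eqP; rewrite -subr_eq0; apply/eqP.
case: m m_neq0 mxy0 => m m_neq0 mxy0.
  by apply: (@padic_natr_eq0 m); rewrite ?lt0n.
apply: (@padic_natr_eq0 m.+1) => //.
by apply/eqP; rewrite -oppr_eq0 -mulNr; apply/eqP.
Qed.

Lemma padic_intr_inj : injective (intr : int -> padic p).
Proof.
move=> a b /eqP; rewrite -subr_eq0 -rmorphB => ab0; apply/eqP.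
rewrite -subr_eq0; apply/negP => /negP /padic_intr_lreg reg.
by move: (reg 1 0); rewrite mulr1 mulr0 => /(_ (eqP ab0)) /eqP; rewrite oner_eq0.
Qed.

End PadicTheory.

(** * From local to global: divisibility, approximation, lattices *)

Lemma dvdz_local (D a : int) :
    D != 0 -> (forall p, prime p -> exists x : padic p, a%:~R = D%:~R * x) ->
  exists b, a = D * b.
Proof.
move=> D_neq0 dvd_a.
suff /dvdzP[b ->] : (D %| a)%Z by exists b; rewrite mulrC.
rewrite dvdzE; apply/dvdn_partP; first by rewrite absz_gt0.
move=> p; rewrite mem_primes => /andP[p_pr _].
have [x ax] := dvd_a p p_pr; rewrite p_part.
have norm_int (c : int) : exists u : padic p,
    `|c|%N%:R = u * c%:~R /\ c%:~R = u * `|c|%N%:R.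
  case: c => c; first by exists 1; rewrite !mul1r.
  exists (-1); rewrite !mulN1r NegzE abszN absz_nat rmorphN opprK.
  by split.
have [u [aE _]] := norm_int a; have [v [_ DE]] := norm_int D.
have /dvdnP[c Dc] := pfactor_dvdnn p `|D|%N.
apply: (@padic_dvd_nat p p_pr _ _ (u * v * c%:R * x)).
by rewrite aE ax DE {2}Dc natrM; ring.
Qed.

(** The primes that divide D are treated by the Chinese remainder theorem; at
    the others D is a unit and there is nothing to approximate. *)
Lemma crt_padic (D : int) (x : forall p, padic p) :
    D != 0 ->
  exists a : int, forall p, prime p ->
    exists y : padic p, a%:~R = x p + D%:~R * y.
Proof.
move=> D_neq0; pose v p := logn p `|D|%N.
have /choice[c cP] p : exists c : nat, prime p ->
    exists y, x p = c%:R + (p ^ v p)%:R * y.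
  by case: (boolP (prime p)) => [/padic_approx/(_ (x p) (v p))[c]|_];
    [exists c | exists 0%N].
have [a aP] : exists a : nat, forall p, p \in primes `|D|%N ->
    (a = c p %[mod p ^ v p])%N.
  have := primes_uniq `|D|%N; have : all prime (primes `|D|%N).
    by apply/allP => p; rewrite mem_primes => /andP[].
  elim: (primes _) => [|p s IHs] /=; first by exists 0%N.
  move=> /andP[p_pr s_pr] /andP[p_s /(IHs s_pr)[b bP]].
  pose P := (\prod_(q <- s) q ^ v q)%N.
  have co_pP : coprime (p ^ v p) P.
    rewrite coprimeXl // /P big_seq.
    apply: (big_ind (coprime p)) => [|m n|q q_s].
    - by rewrite coprimen1.
    - by rewrite coprimeMr => -> ->.
    rewrite coprimeXr // prime_coprime // dvdn_prime2 ?(allP s_pr q q_s) //.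
    by apply: contraNneq p_s => ->.
  apply: (ex_intro _ (chinese (p ^ v p) P (c p) b)) => q; rewrite inE.
  case/predU1P => [->|q_s]; first by rewrite chinese_modl.
  have dq : (q ^ v q %| P)%N by rewrite /P (big_rem q) //= dvdn_mulr.
  by rewrite -bP // -(modn_dvdm _ dq) chinese_modr // modn_dvdm.
exists a%:Z; move=> p p_pr; rewrite -pmulrn.
have ac : (a = c p %[mod p ^ v p])%N.
  case: (boolP (p \in primes `|D|%N)) => [/aP //|p_D].
  suff -> : v p = 0%N by rewrite !modn1.
  apply/eqP; rewrite /v eqn0Ngt logn_gt0; exact: p_D.
have [y0 xE] := cP p p_pr.
have [y1 acE] : exists y1 : padic p, a%:R = (c p)%:R + (p ^ v p)%:R * y1.
  exists ((a %/ p ^ v p)%:R - (c p %/ p ^ v p)%:R).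
  rewrite {1}(divn_eq a (p ^ v p)) {1}(divn_eq (c p) (p ^ v p)) ac.
  by rewrite !(natrD, natrM); ring.
have D_gt0 : (0 < `|D|)%N by rewrite absz_gt0.
have [m co_m DE] := pfactor_coprime p_pr D_gt0.
have [u mu] : exists u : padic p, m%:R * u = 1.
  by apply: padic_coprime_unit; rewrite // coprime_sym.
have [w Dw] : exists w : padic p, D%:~R * w = (`|D|%N)%:R.
  case: (D) => n; [exists 1 | exists (-1)]; first by rewrite mulr1.
  by rewrite NegzE abszN absz_nat rmorphN mulrN1 opprK.
have pvE : (p ^ v p)%:R = D%:~R * (w * u) :> padic p.
  by rewrite mulrA Dw DE natrM -/(v p) mulrAC mu mul1r.
by exists (w * u * (y1 - y0)); rewrite mulrA -pvE acE xE; ring.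
Qed.

Lemma exists_scalemx (R : pzRingType) r c (d : R) (M : 'M[R]_(r, c)) :
  (forall i j, exists y, M i j = d * y) -> exists Y, M = d *: Y.
Proof.
move=> dM; have /choice[y yP] (ij : 'I_r * 'I_c) : exists z, M ij.1 ij.2 = d * z.
  exact: dM.
by exists (\matrix_(i, j) y (i, j)); apply/matrixP => i j; rewrite !mxE -yP.
Qed.

Lemma crt_mx (D : int) r c (X : forall p, 'M[padic p]_(r, c)) :
    D != 0 ->
  exists A : 'M[int]_(r, c), forall p, prime p ->
    exists Y : 'M[padic p]_(r, c), map_mx intr A = X p + D%:~R *: Y.
Proof.
move=> D_neq0.
have /choice[a aP] (ij : 'I_r * 'I_c) := crt_padic (fun p => X p ij.1 ij.2) D_neq0.
exists (\matrix_(i, j) a (i, j)); move=> p p_pr.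
have [|Y YE] := @exists_scalemx _ r c (D%:~R : padic p)
    (map_mx intr (\matrix_(i, j) a (i, j)) - X p).
  move=> i j; have [y yE] := aP (i, j) p p_pr; exists y.
  by rewrite !mxE yE /= addrAC subrr add0r.
by exists Y; rewrite -YE addrC subrK.
Qed.

Lemma dvd_mx_local (D : int) r c (A : 'M[int]_(r, c)) :
    D != 0 ->
    (forall p, prime p ->
       exists X : 'M[padic p]_(r, c), map_mx intr A = D%:~R *: X) ->
  exists B, A = D *: B.
Proof.
move=> D_neq0 dvdA; apply: exists_scalemx => i j; apply: dvdz_local => // p p_pr.
have [X /matrixP/(_ i j)] := dvdA p p_pr; rewrite !mxE => ->.
by exists (X i j).
Qed.

Section RegularDet.
Variable R : comNzRingType.

Lemma lregW (a b : R) : GRing.lreg (a * b) -> GRing.lreg b.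
Proof. by move=> ab x y bxy; apply: ab; rewrite -!mulrA bxy. Qed.

Lemma lreg_scalemx r c (a : R) (Y Z : 'M[R]_(r, c)) :
  GRing.lreg a -> a *: Y = a *: Z -> Y = Z.
Proof.
move=> a_reg /matrixP aYZ; apply/matrixP => i j.
by apply: a_reg; have := aYZ i j; rewrite !mxE.
Qed.

Lemma mulmx_det_inj r m (X : 'M[R]_m) (Y Z : 'M[R]_(r, m)) :
  GRing.lreg (\det X) -> Y *m X = Z *m X -> Y = Z.
Proof.
move=> X_reg YZ; apply: (lreg_scalemx X_reg).
by rewrite -!mul_mx_scalar -mul_mx_adj !mulmxA YZ.
Qed.

Lemma mulmx_det_injl r m (X : 'M[R]_m) (Y Z : 'M[R]_(m, r)) :
  GRing.lreg (\det X) -> X *m Y = X *m Z -> Y = Z.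
Proof.
move=> X_reg YZ; apply: (lreg_scalemx X_reg).
by rewrite -!mul_scalar_mx -mul_adj_mx -!mulmxA YZ.
Qed.

End RegularDet.

(** Class number one for GL_m over the rationals: the rows of the X p span
    local lattices that contain D times the standard one, hence come from a
    global lattice, which is free.  That lattice is spanned by D times the
    standard basis and by integer approximations of the rows of the X p. *)
Lemma local_lattice_basis m (D : int) (X : forall p, 'M[padic p]_m) :
    D != 0 ->
    (forall p, prime p -> exists X', X' *m X p = (D%:~R)%:M) ->
  exists B : 'M[int]_m, forall p, prime p -> exists K K' : 'M[padic p]_m,
    X p = K *m map_mx intr B /\ K *m K' = 1%:M.
Proof.
move=> D_neq0 dvdD; have [X0 X0E] := crt_mx X D_neq0.
have [L L_unit [R _ [d _ LdR]]] := int_Smith_normal_form (col_mx X0 D%:M).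
pose B := usubmx (\matrix_(i < m + m, j < m) (d`_i *+ (i == j :> nat))) *m R.
have LB : col_mx X0 D%:M = L *m col_mx B 0.
  rewrite LdR -mulmxA; congr (_ *m _); rewrite -[X in X *m R]vsubmxK.
  rewrite mul_col_mx; congr col_mx; rewrite [dsubmx _](_ : _ = 0) ?mul0mx //.
  apply/matrixP => i j; rewrite !mxE /= gtn_eqF ?mulr0n //.
  by rewrite ltn_addr.
have BL : invmx L *m col_mx X0 D%:M = col_mx B 0 by rewrite LB mulKmx.
have X0B : X0 = ulsubmx L *m B.
  by move: LB; rewrite -{1}[L]submxK mul_block_col !mulmx0 !addr0 => /eq_col_mx[].
have DB : D%:M = dlsubmx L *m B.
  by move: LB; rewrite -{1}[L]submxK mul_block_col !mulmx0 !addr0 => /eq_col_mx[].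
have BE : B = ulsubmx (invmx L) *m X0 + D *: ursubmx (invmx L).
  move: BL; rewrite -{1}[invmx L]submxK mul_block_col => /eq_col_mx[<- _].
  by rewrite mul_mx_scalar.
exists B; move=> p p_pr; have [X' X'X] := dvdD p p_pr.
have [Y X0Y] := X0E p p_pr; pose i_ := map_mx (intr : int -> padic p).
pose K := i_ _ _ (ulsubmx L) - Y *m i_ _ _ (dlsubmx L).
pose K' := i_ _ _ (ulsubmx (invmx L)) +
  (i_ _ _ (ulsubmx (invmx L)) *m Y + i_ _ _ (ursubmx (invmx L))) *m X'.
have XK : X p = K *m i_ _ _ B.
  rewrite mulmxBl -mulmxA -!map_mxM -X0B -DB map_scalar_mx mul_mx_scalar.
  by rewrite X0Y addrK.
have BK' : i_ _ _ B = K' *m X p.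
  rewrite mulmxDl -mulmxA X'X mul_mx_scalar /i_ {1}BE map_mxD map_mxM X0Y.
  by rewrite map_mxZ mulmxDr -scalemxAr -addrA -scalerDr.
exists K, K'; split=> //.
have detX : GRing.lreg (\det (X p)).
  apply: (@lregW _ (\det X')); rewrite -det_mulmx X'X det_scalar -rmorphXn.
  by apply: padic_intr_lreg; rewrite // expf_neq0.
by apply: (mulmx_det_inj detX); rewrite mul1mx -mulmxA -BK' -XK.
Qed.

(** * Symmetric pencils vanishing on the rational normal curve *)

Section SymmetricPencils.
Variable R : comNzRingType.

Lemma sum_antidiag_split (c : nat -> nat -> R) k i j :
    (forall x y, c x y = c y x) -> (i + j = k.+1)%N ->
  \sum_(0 <= l < k.+1) c l (k - l)%N =
    \sum_(0 <= l < i) c l (k - l)%N + \sum_(0 <= l < j) c l (k - l)%N.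
Proof.
move=> c_sym ijk; rewrite (@big_cat_nat _ _ _ i) /=; [|lia|lia].
congr (_ + _); rewrite -{1}[i]add0n big_addn -ijk addKn big_nat_rev /= !big_nat.
by apply: eq_bigr => l /andP[_ l_j]; rewrite c_sym; congr (c _ _); lia.
Qed.

Section Solution.
Variables (n : nat) (a b : nat -> nat -> R).
Hypotheses (a_sym : forall i j, a i j = a j i).
Hypotheses (b_sym : forall i j, b i j = b j i).
Hypotheses (a_out : forall i j, (n < j)%N -> a i j = 0).
Hypotheses (b_out : forall i j, (n < j)%N -> b i j = 0).
Hypothesis ab_sum : forall k,
  \sum_(0 <= l < k.+2) b l (k.+1 - l)%N = \sum_(0 <= l < k.+1) a l (k - l)%N.

(** The solution of w i j + w j i = a i j, w (i+1) j + w (j+1) i = b (i+1) (j+1)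
    obtained by following an antidiagonal from its upper end: the equations give
    w (i+1) j = w i (j+1) + b (i+1) (j+1) - a i (j+1). *)
Definition antidiag_sol i j : R :=
  \sum_(0 <= l < i.+1) b l ((i + j).+1 - l)%N
  - \sum_(0 <= l < i) a l (i + j - l)%N.
Local Notation w := antidiag_sol.

Lemma antidiag_solD i j : w i j + w j i = a i j.
Proof.
rewrite /w (addnC j i) addrACA -opprD -sum_antidiag_split //; last by lia.
rewrite ab_sum (@sum_antidiag_split a _ i j.+1) //; last by lia.
rewrite [X in _ + X - _]big_nat_recr //= addnK a_sym. ring.

Qed.

Lemma antidiag_solS i j : w i.+1 j + w j.+1 i = b i.+1 j.+1.
Proof.
rewrite /w (_ : j.+1 + i = i.+1 + j)%N; last by lia.
rewrite addrACA -opprD -(@sum_antidiag_split a) //; last by lia.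
rewrite [X in _ + X - _]big_nat_recr //= addrA.
rewrite -(@sum_antidiag_split b) //; last by lia.
rewrite ab_sum addrAC subrr add0r b_sym; congr (b _ _); lia.
Qed.

Lemma antidiag_sol_out i : (i <= n)%N -> w i n = 0.
Proof.
move=> le_in; rewrite /w !big_nat !big1 ?subrr // => l /andP[_ l_i].
  by apply: a_out; lia.
by apply: b_out; lia.
Qed.

Lemma antidiag_sol0 j : w 0 j = b 0 j.+1.
Proof. by rewrite /w big_nat1 big_geq // subr0 subn0 add0n. Qed.

End Solution.

Variable n : nat.

(** The block matrices [I | 0] and [0 | I]; rpad - t lpad is the Kronecker block
    whose kernel is spanned by (1, t, ..., t^n). *)
Definition lpad : 'M[R]_(n, n.+1) := \matrix_(i, j) (j == i :> nat)%:R.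
Definition rpad : 'M[R]_(n, n.+1) := \matrix_(i, j) (j == i.+1 :> nat)%:R.

Definition powers : 'cV[{poly R}]_n.+1 := \col_i 'X^i.

Lemma mul_lpad r (W : 'M[R]_(r, n)) i (j : 'I_n.+1) (k : 'I_n) :
  j = k :> nat -> (W *m lpad) i j = W i k.
Proof.
move=> jk; rewrite mxE (bigD1 k) //= big1 => [|l l_k]; rewrite !mxE jk ?eqxx.
  by rewrite mulr1 addr0.
by rewrite eq_sym -[_ == _]/(l == k) (negPf l_k) mulr0.
Qed.

Lemma mul_lpad_max r (W : 'M[R]_(r, n)) i : (W *m lpad) i ord_max = 0.
Proof.
rewrite mxE big1 // => k _; rewrite mxE /= gtn_eqF ?mulr0 //; exact: ltn_ord.
Qed.

Lemma mul_rpad r (W : 'M[R]_(r, n)) i (j : 'I_n.+1) (k : 'I_n) :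
  j = k.+1 :> nat -> (W *m rpad) i j = W i k.
Proof.
move=> jk; rewrite mxE (bigD1 k) //= big1 => [|l l_k]; rewrite !mxE jk ?eqxx.
  by rewrite mulr1 addr0.
by rewrite eq_sym eqSS -[_ == _]/(l == k) (negPf l_k) mulr0.
Qed.

Lemma mul_rpad0 r (W : 'M[R]_(r, n)) i : (W *m rpad) i 0 = 0.
Proof. by rewrite mxE big1 // => k _; rewrite mxE /= mulr0. Qed.

Definition mxval (A : 'M[R]_n.+1) (i j : nat) : R :=
  if (i <= n)%N && (j <= n)%N then A (inord i) (inord j) else 0.

Lemma mxvalE A (i j : 'I_n.+1) : mxval A i j = A i j.
Proof. by rewrite /mxval -[(i <= n)%N]ltnS -[(j <= n)%N]ltnS !ltn_ord !inord_val. Qed.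

Lemma mxval_sym A : A^T = A -> forall i j, mxval A i j = mxval A j i.
Proof. by move=> A_sym i j; rewrite /mxval andbC -{1}A_sym mxE. Qed.

Lemma sum_nat_support (h : nat -> R) m M :
    (m <= M)%N -> (forall l, (m <= l)%N -> h l = 0) ->
  \sum_(0 <= l < M) h l = \sum_(0 <= l < m) h l.
Proof.
move=> le_mM h0; rewrite (@big_cat_nat _ _ _ m) //=.
by rewrite [X in _ + X]big_nat [X in _ + X]big1 ?addr0 // => l /andP[/h0].
Qed.

Lemma coef_powers_mul r (A : 'M[R]_(n.+1, r)) i k :
  ((powers^T *m map_mx polyC A) 0 i)`_k
  = if (k <= n)%N then A (inord k) i else 0.
Proof.
rewrite mxE coef_sum.
under eq_bigr => j _ do rewrite !mxE mulrC mul_polyC coefZ coefXn.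
case: leqP => [le_kn|lt_nk].
  rewrite (bigD1 (inord k)) //= inordK // eqxx mulr1 big1 ?addr0 // => j.
  rewrite -val_eqE /= inordK // => j_k.
  by rewrite eq_sym (negPf j_k) mulr0.
by rewrite big1 // => j _; rewrite gtn_eqF ?mulr0 // (leq_trans (ltn_ord j)).
Qed.

Lemma coef_quadratic_powers (A : 'M[R]_n.+1) k :
  ((powers^T *m map_mx polyC A *m powers) 0 0)`_k
  = \sum_(0 <= l < k.+1) mxval A l (k - l)%N.
Proof.
rewrite mxE coef_sum big_nat_rev add0n /=.
pose h l := if (l <= k)%N then mxval A (k - l) l else 0.
transitivity (\sum_(0 <= l < n.+1) h l).
  rewrite big_mkord; apply: eq_bigr => j _.
  rewrite [powers _ _]mxE coefMXn ltnNge /h; case: leqP => //= le_jk.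
  rewrite coef_powers_mul /mxval -[(j <= n)%N]ltnS ltn_ord andbT.
  by rewrite inord_val.
rewrite -(@sum_nat_support h n.+1 (n.+1 + k.+1)) ?leq_addr //; last first.
  by move=> l n_l; rewrite /h /mxval [(l <= n)%N]leqNgt n_l andbF if_same.
rewrite (@sum_nat_support h k.+1) ?leq_addl //; last first.
  by move=> l k_l; rewrite /h leqNgt k_l.
rewrite !big_nat; apply: eq_bigr => l /andP[_ l_k].
by rewrite /h -ltnS l_k subSS subKn.
Qed.

(** The symmetric pencils A - tB that vanish on the powers of t.  Over the
    polynomial ring, the syzygies of (1, t, ..., t^n) are spanned by the rows
    of rpad - t lpad, so such a pencil is a symmetrized multiple of that
    matrix.  The explicit solution avoids dividing by 2, which matters over
    the 2-adic integers. *)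
Lemma symmetric_pencil_sol (A B : 'M[R]_n.+1) :
    A^T = A -> B^T = B ->
    (powers^T *m (map_mx polyC A - 'X *: map_mx polyC B) *m powers) 0 0 = 0 ->
  exists W : 'M[R]_(n.+1, n),
    A = W *m rpad + (W *m rpad)^T /\ B = W *m lpad + (W *m lpad)^T.
Proof.
move=> A_sym B_sym /polyP AB0.
have AB_coef k : \sum_(0 <= l < k.+1) mxval A l (k - l)%N =
    if k is k'.+1 then \sum_(0 <= l < k) mxval B l (k' - l)%N else 0.
  apply/eqP; rewrite -subr_eq0 -coef_quadratic_powers; apply/eqP.
  move: (AB0 k); rewrite mulmxBr mulmxBl -scalemxAr -scalemxAl.
  rewrite mxE [X in _ + X]mxE [X in - X]mxE mxE.
  rewrite coefB coefXM coef0; case: k => [|k] //=.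
  by rewrite coef_quadratic_powers.
have out C i j : (n < j)%N -> mxval C i j = 0.
  by move=> n_j; rewrite /mxval [(j <= n)%N]leqNgt n_j andbF.
pose w := antidiag_sol (mxval B) (mxval A).
have wB := @antidiag_solD (mxval B) (mxval A) (mxval_sym B_sym)
  (mxval_sym A_sym) (fun k => AB_coef k.+1).
have wA := @antidiag_solS (mxval B) (mxval A) (mxval_sym B_sym)
  (mxval_sym A_sym) (fun k => AB_coef k.+1).
have w_out := @antidiag_sol_out n (mxval B) (mxval A) (out B) (out A).
pose W : 'M[R]_(n.+1, n) := \matrix_(i, j) w i j.
have WlE i j : (W *m lpad) i j = w i j.
  case: (ltnP j n) => [j_n|n_j].
    by rewrite (@mul_lpad _ _ _ _ (Ordinal j_n)) // mxE.
  have -> : j = ord_max by apply/val_inj/eqP; rewrite /= eqn_leq n_j -ltnS ltn_ord.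
  by rewrite mul_lpad_max /w w_out // -ltnS.
have WrE i (j : 'I_n.+1) : (W *m rpad) i j = if j : nat is j'.+1 then w i j' else 0.
  case: j => [[|j] j_n]; first by rewrite -(mul_rpad0 W i); congr (_ _ _); apply: val_inj.
  by rewrite (@mul_rpad _ _ _ _ (Ordinal (j_n : (j < n)%N))) // mxE.
exists W; split; apply/matrixP => i j; rewrite [RHS]mxE [X in _ + X]mxE.
  rewrite !WrE -mxvalE; case: (i : nat) (j : nat) => [|i'] [|j'].
  - by move: (AB_coef 0%N); rewrite big_nat1 addr0.
  - by rewrite addr0 /w antidiag_sol0.
  - by rewrite add0r /w antidiag_sol0 mxval_sym.
  by rewrite wA.
by rewrite !WlE wB mxvalE.
Qed.

(** Comparing entries moves the index of a row of W down by one while keeping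
    the antidiagonal, until the row leaves the matrix. *)
Lemma symmetric_pencil_sol0 (W : 'M[R]_(n.+1, n)) :
    W *m rpad + (W *m rpad)^T = 0 -> W *m lpad + (W *m lpad)^T = 0 ->
  W = 0.
Proof.
move=> Wr Wl.
have Wr' i j : (W *m rpad) i j + (W *m rpad) j i = 0.
  have e : (W *m rpad + (W *m rpad)^T) i j = 0 by rewrite Wr mxE.
  by rewrite -[RHS]e [RHS]mxE [X in _ = _ + X]mxE.
have Wl' i j : (W *m lpad) i j + (W *m lpad) j i = 0.
  have e : (W *m lpad + (W *m lpad)^T) i j = 0 by rewrite Wl mxE.
  by rewrite -[RHS]e [RHS]mxE [X in _ = _ + X]mxE.
suff W0 m : forall (i : 'I_n.+1) j, i = m :> nat -> W i j = 0.
  by apply/matrixP => i j; rewrite mxE; apply: W0.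
elim: m => [|m IHm] i j im.
  have := Wr' i (lift ord0 j); rewrite (@mul_rpad _ _ _ _ j) //.
  have -> : i = 0 by apply: val_inj.
  by rewrite mul_rpad0 addr0.
have m_n : (m < n)%N by rewrite -ltnS -im ltn_ord.
have := Wr' i (lift ord0 j); rewrite (@mul_rpad _ _ _ _ j) //.
rewrite (@mul_rpad _ _ _ _ (Ordinal m_n)) // => /eqP; rewrite addr_eq0 => /eqP->.
have := Wl' (lift ord0 j) (Ordinal (ltnW m_n : (m < n.+1)%N)).
rewrite (@mul_lpad _ _ _ _ (Ordinal m_n)) // => /eqP; rewrite addr_eq0 => /eqP->.
rewrite opprK; case: (ltnP j.+1 n) => [j_n|n_j].
  by rewrite (@mul_lpad _ _ _ _ (Ordinal j_n)) // IHm.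
rewrite (_ : lift ord0 j = ord_max) ?mul_lpad_max //.
by apply/val_inj/eqP; rewrite /= eqn_leq n_j -ltnS !ltnS ltn_ord.
Qed.

End SymmetricPencils.

(** * Maximal minors of an n x (n+1) matrix *)

Section MaximalMinors.

(** Cofactors along an additional first row, on whose entries they do not
    depend. *)
Definition minors (R : comNzRingType) n (M : 'M[R]_(n, n.+1)) : 'cV[R]_n.+1 :=
  \col_j cofactor (col_mx (0 : 'rV_n.+1) M : 'M_n.+1) 0 j.

Lemma map_minors (R S : comNzRingType) (f : {rmorphism R -> S}) n
    (M : 'M[R]_(n, n.+1)) :
  map_mx f (minors M) = minors (map_mx f M).
Proof.
apply/matrixP => j k; rewrite !mxE -cofactor_map_mx.
by rewrite -(raddf0 (map_mx f)) -(map_col_mx f (0 : 'rV_n.+1) M).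
Qed.

Variables (R : comNzRingType) (n : nat).
Implicit Types (M : 'M[R]_(n, n.+1)) (r : 'rV[R]_n.+1).

Lemma row'0_col_mx r M : row' 0 (col_mx r M : 'M_n.+1) = M.
Proof.
apply/matrixP => i k; rewrite mxE -(col_mxEd r M); congr (col_mx r M _ k).
exact: val_inj.
Qed.

Lemma cofactor0_det r M j :
  cofactor (col_mx r M : 'M_n.+1) 0 j = (-1) ^+ j * \det (col' j M).
Proof.
rewrite /cofactor add0n -[in RHS](row'0_col_mx r M); congr (_ * \det _).
by apply/matrixP => i k; rewrite !mxE.
Qed.

Lemma minors_det M j : minors M j 0 = (-1) ^+ j * \det (col' j M).
Proof. by rewrite mxE cofactor0_det. Qed.

Lemma cofactor_col_mx r M j :
  cofactor (col_mx r M : 'M_n.+1) 0 j = minors M j 0.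
Proof. by rewrite cofactor0_det minors_det. Qed.

Lemma det_col_mx r M :
  \det (col_mx r M : 'M_n.+1) = (r *m minors M) 0 0.
Proof.
rewrite (expand_det_row _ 0) mxE; apply: eq_bigr => j _.
rewrite cofactor_col_mx; congr (_ * _).
by rewrite -(col_mxEu r M); congr (col_mx r M _ j); apply: val_inj.
Qed.

Lemma mul_minors M : M *m minors M = 0.
Proof.
apply/matrixP => i j; rewrite ord1 [RHS]mxE.
have : \det (col_mx (row i M) M : 'M_n.+1) = 0.
  apply: (@determinant_alternate _ _ _ 0 (rshift 1 i)) => // k.
  rewrite (col_mxEd (row i M) M) (_ : (0 : 'I_n.+1) = lshift n (0 : 'I_1)).
    by rewrite (col_mxEu (row i M) M) mxE.
  exact: val_inj.
by rewrite det_col_mx -row_mul mxE.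
Qed.

Lemma row_mul_ext (u v : 'cV[R]_n.+1) :
  (forall r, (r *m u) 0 0 = (r *m v) 0 0) -> u = v.
Proof.
move=> uv; apply/matrixP => j k; rewrite ord1.
by have := uv (delta_mx 0 j); rewrite -!rowE !mxE.
Qed.

(** Compare the determinants of col_mx (r *m H) (K *m M *m H) and col_mx r M
    for every row r. *)
Lemma minors_mul M (K : 'M_n) (H : 'M_n.+1) :
  H *m minors (K *m M *m H) = (\det K * \det H) *: minors M.
Proof.
apply: row_mul_ext => r.
rewrite mulmxA -det_col_mx -scalemxAr mxE -det_col_mx.
have -> : col_mx (r *m H) (K *m M *m H) =
          (block_mx 1%:M 0 0 K : 'M_(1 + n)) *m col_mx r M *m H.
  by rewrite mul_block_col mul1mx !mul0mx addr0 add0r mul_col_mx.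
rewrite [in LHS](@det_mulmx _ n.+1) [in LHS](@det_mulmx _ n.+1).
by rewrite (@det_ublock _ 1 n) det1 mul1r mulrAC.
Qed.

Lemma minors_mul_ker M (s : 'rV_n) : s *m M = 0 -> minors M *m s = 0.
Proof.
move=> sM0; apply/matrixP => j k; rewrite mxE big_ord1 [RHS]mxE.
pose C : 'M_(1 + n) := col_mx (delta_mx 0 j) M.
have uC : row_mx 0 s *m C = 0 by rewrite mul_row_col mul0mx add0r.
have: \det C *: row_mx (0 : 'M_1) s = 0.
  by rewrite -mul_mx_scalar -mul_mx_adj mulmxA uC mul0mx.
rewrite /C det_col_mx -rowE mxE => /(congr1 (fun u => rsubmx u 0 k)).
by rewrite linearZ /= row_mxKr linear0 !mxE.
Qed.

(** When r is a syzygy of the minors, the square matrix col_mx r M is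
    singular, and the product with its adjugate expresses the multiples of r
    by the minors through the rows of M. *)
Lemma minors_syzygy M r :
  r *m minors M = 0 ->
  minors M *m r =
    - (rsubmx (\adj (col_mx r M) : 'M_(1 + n)) *m M).
Proof.
move=> rM0; pose C : 'M_(1 + n) := col_mx r M.
have : \adj C *m C = 0.
  by rewrite mul_adj_mx det_col_mx rM0 mxE raddf0.
rewrite -{1}[\adj C]hsubmxK mul_row_col.
have -> : lsubmx (\adj C) = minors M.
  apply/matrixP => j k; rewrite ord1 [LHS]mxE [LHS]mxE -(cofactor_col_mx r).
  by congr (cofactor _ _ _); apply: val_inj.
by move/eqP; rewrite addr_eq0 => /eqP.
Qed.

Definition bordered M (S : 'M_n.+1) : 'M[R]_(n + n.+1) := block_mx 0 M M^T S.

(** Conjugating by the adjugate of a completion C of M replaces M by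
    det C times [0 | I], and the determinant becomes a triangular one. *)
Lemma det_bordered_lreg (C S : 'M_(1 + n)) :
    GRing.lreg (\det C) ->
  \det (bordered (dsubmx C) S) =
    (-1) ^+ n * ((minors (dsubmx C))^T *m S *m minors (dsubmx C)) 0 0.
Proof.
move=> C_reg; set M := dsubmx C; set v := minors M; pose rho := \det C.
pose M0 : 'M[R]_(n, 1 + n) := row_mx 0 1%:M.
pose E : 'M[R]_(1 + n) := block_mx 1%:M 0 0 0.
pose T := (\adj C)^T *m S *m \adj C.
pose X : 'M[R]_(n + n.+1) := block_mx 1%:M 0 0 (\adj C)^T.
have M0M0 : M0 *m M0^T = 1%:M.
  by rewrite tr_row_mx mul_row_col trmx0 mul0mx add0r trmx1 mul1mx.
have M0TM0 : M0^T *m M0 = block_mx 0 0 0 1%:M.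
  by rewrite tr_row_mx mul_col_row trmx0 trmx1 !mul0mx !mul1mx.
have EM0 : M0 *m E = 0.
  by rewrite mul_row_block !mul0mx !mulmx0 !addr0 row_mx0.
have det_Q : \det (bordered M0 E) = (-1) ^+ n.
  have -> : bordered M0 E = block_mx 1%:M M0 0 1%:M *m
      block_mx 1%:M 0 (- M0^T) 1%:M *m block_mx 1%:M M0 0 1%:M *m
      block_mx (- 1%:M) 0 0 1%:M.
    rewrite !mulmx_block !mulmx0 !mul0mx !mulmx1 !mul1mx !addr0 !add0r.
    rewrite [M0 *m - _]mulmxN M0M0 subrr !mul0mx add0r !mulmxN !mulNmx mulmx1.
    rewrite opprK M0TM0 scalar_mx_block opp_block_mx add_block_mx.
    by rewrite !oppr0 !addr0 add0r addNr.
  rewrite !det_mulmx !det_ublock det_lblock !det1 !mul1r !mulr1.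
  by rewrite -scaleN1r detZ det1 mulr1.
have MC : M *m \adj C = rho *: M0.
  rewrite mul_dsub_mx mul_mx_adj -/rho scalar_mx_block /block_mx col_mxKd.
  by rewrite scale_row_mx scaler0 scalemx1.
have XBX : X *m bordered M S *m X^T *m bordered M0 E =
    block_mx (rho%:M) 0 (T *m M0^T) (rho *: block_mx 0 0 0 1%:M + T *m E).
  have -> : X *m bordered M S *m X^T = bordered (rho *: M0) T.
    rewrite tr_block_mx !trmx0 trmx1 trmxK !mulmx_block.
    rewrite !(mul0mx, mulmx0, mul1mx, mulmx1, add0r, addr0) MC.
    by rewrite -trmx_mul MC.
  rewrite mulmx_block !(mul0mx, mulmx0, add0r, addr0) -scalemxAl M0M0 scalemx1.
  rewrite -scalemxAl EM0 scaler0; congr block_mx.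
  by rewrite linearZ /= -scalemxAl M0TM0.
have v_adj : col 0 (\adj C) = v.
  apply/matrixP => j k; rewrite mxE [LHS]mxE ord1.
  rewrite -(cofactor_col_mx (usubmx C)) vsubmxK.
  by congr (cofactor _ _ _); apply: val_inj.
pose t := (v^T *m S *m v) 0 0.
have detTE : \det (rho *: block_mx 0 0 0 1%:M + T *m E) = t * rho ^+ n.
  rewrite -[T]submxK mulmx_block !(mulmx0, mulmx1, addr0).
  rewrite scale_block_mx add_block_mx !scaler0 !addr0 !add0r scalemx1.
  rewrite det_lblock det_scalar det_mx11; congr (_ * _).
  suff -> : ulsubmx T 0 0 = (row 0 (\adj C)^T *m S *m col 0 (\adj C)) 0 0.
    by rewrite -tr_col v_adj.
  have -> : ulsubmx T 0 0 = T (lshift n 0) (lshift n 0).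
    by rewrite [LHS]mxE [LHS]mxE.
  rewrite (_ : lshift n 0 = 0); last exact: val_inj.
  rewrite -row_mul /T mxE [RHS]mxE.
  by apply: eq_bigr => j _; rewrite [X in _ = X * _]mxE [X in _ = _ * X]mxE.
have: \det (X *m bordered M S *m X^T *m bordered M0 E) = rho ^+ n * (t * rho ^+ n).
  by rewrite XBX det_lblock det_scalar detTE.
rewrite !det_mulmx det_tr det_Q /X det_ublock det1 mul1r det_tr => e.
have det_adj : rho * \det (\adj C) = rho ^+ n.+1.
  by rewrite -det_mulmx mul_mx_adj det_scalar.
apply: (@GRing.lregX _ rho (n.+1 + n.+1)%N C_reg).
transitivity (rho ^+ 2 * (-1) ^+ n *
  (\det (\adj C) * \det (bordered M S) * \det (\adj C) * (-1) ^+ n)).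
  have sgn : (-1) ^+ n * (-1) ^+ n = 1 :> R by rewrite -exprMn mulrNN mulr1 expr1n.
  rewrite exprD -det_adj -[in LHS](mul1r (\det (bordered M S))) -[in LHS]sgn.
  by rewrite expr2; ring.
by rewrite e -/t exprD !exprS; ring.
Qed.

End MaximalMinors.

(** The completion C of the previous lemma must have a regular determinant.
    Adding a variable to the diagonal of any completion of M makes its
    determinant monic; the variable is then specialized to 0. *)
Lemma det_bordered (R : comNzRingType) n (M : 'M[R]_(n, n.+1)) (S : 'M_n.+1) :
  \det (bordered M S) = (-1) ^+ n * ((minors M)^T *m S *m minors M) 0 0.
Proof.
pose C : 'M[R]_(1 + n) := col_mx 0 M.
pose C' := char_poly_mx (- C).
have C'_reg : GRing.lreg (\det C').
  by apply: monic_lreg; apply: (char_poly_monic (- C)).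
pose ev : {rmorphism {poly R} -> R} := horner_eval 0.
have evP r c (A : 'M[R]_(r, c)) : map_mx ev (map_mx polyC A) = A.
  by apply/matrixP => i j; rewrite !mxE /= horner_evalE hornerC.
have evC' : map_mx ev (dsubmx C') = M.
  rewrite map_dsubmx /C' /char_poly_mx map_mxB map_scalar_mx evP.
  by rewrite /= horner_evalE hornerX raddf0 sub0r opprK col_mxKd.
have := congr1 ev (det_bordered_lreg (map_mx polyC S) C'_reg).
rewrite -det_map_mx rmorphM rmorphXn rmorphN1 => e.
have -> : bordered M S = map_mx ev (bordered (dsubmx C') (map_mx polyC S)).
  by rewrite map_block_mx raddf0 -map_trmx evC' evP.
rewrite e; congr (_ * _).
transitivity (map_mx ev ((minors (dsubmx C'))^T *m map_mx polyC S *m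
  minors (dsubmx C')) 0 0); first by rewrite [RHS]mxE.
by rewrite !map_mxM -map_trmx map_minors evP evC'.
Qed.

(** * The coefficients of the minors and the resultant *)

Section Degrees.
Variable R : comNzRingType.

Definition mxdeg d r c (A : 'M[{poly R}]_(r, c)) : Prop :=
  forall i j, (size (A i j) <= d.+1)%N.

Lemma mxdegW d e r c (A : 'M_(r, c)) : (d <= e)%N -> mxdeg d A -> mxdeg e A.
Proof. by move=> le_de Ad i j; apply: leq_trans (Ad i j) _. Qed.

Lemma mxdegD d r c (A B : 'M_(r, c)) : mxdeg d A -> mxdeg d B -> mxdeg d (A + B).
Proof.
move=> Ad Bd i j; rewrite mxE (leq_trans (size_polyD _ _)) // geq_max.
by rewrite Ad Bd.
Qed.

Lemma mxdegN d r c (A : 'M_(r, c)) : mxdeg d A -> mxdeg d (- A).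
Proof. by move=> Ad i j; rewrite mxE size_polyN. Qed.

Lemma mxdegB d r c (A B : 'M_(r, c)) : mxdeg d A -> mxdeg d B -> mxdeg d (A - B).
Proof. by move=> Ad Bd; apply/mxdegD/mxdegN. Qed.

Lemma mxdegT d r c (A : 'M_(r, c)) : mxdeg d A -> mxdeg d A^T.
Proof. by move=> Ad i j; rewrite mxE. Qed.

Lemma size_polyM_deg d e (p q : {poly R}) :
  (size p <= d.+1)%N -> (size q <= e.+1)%N -> (size (p * q)%R <= (d + e).+1)%N.
Proof.
move=> pd qe; apply: leq_trans (size_polyMleq p q) _.
by rewrite -subn1 leq_subLR; lia.
Qed.

Lemma mxdegZ d e r c (p : {poly R}) (A : 'M_(r, c)) :
  (size p <= e.+1)%N -> mxdeg d A -> mxdeg (e + d) (p *: A).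
Proof. by move=> pe Ad i j; rewrite mxE size_polyM_deg. Qed.

Lemma mxdegZC d r c (x : R) (A : 'M_(r, c)) : mxdeg d A -> mxdeg d (x%:P *: A).
Proof. exact: mxdegZ (size_polyC_leq1 x). Qed.

Lemma size_sum_deg d (I : Type) (s : seq I) (P : pred I) (F : I -> {poly R}) :
  (forall i, P i -> (size (F i) <= d)%N) -> (size (\sum_(i <- s | P i) F i)%R <= d)%N.
Proof.
move=> Fd; apply: (big_ind (fun p : {poly R} => (size p <= d)%N)) => //.
  by rewrite size_poly0.
by move=> p q pd qd; rewrite (leq_trans (size_polyD _ _)) // geq_max pd.
Qed.

Lemma mxdegM d e r m c (A : 'M_(r, m)) (B : 'M_(m, c)) :
  mxdeg d A -> mxdeg e B -> mxdeg (d + e) (A *m B).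
Proof.
by move=> Ad Be i j; rewrite mxE size_sum_deg // => k _; rewrite size_polyM_deg.
Qed.

Lemma mxdeg_polyC r c (A : 'M[R]_(r, c)) : mxdeg 0 (map_mx polyC A).
Proof. by move=> i j; rewrite mxE size_polyC_leq1. Qed.

Lemma mxdeg_polyCP r c (A : 'M[{poly R}]_(r, c)) :
  mxdeg 0 A -> exists B, A = map_mx polyC B.
Proof.
move=> A0; exists (map_mx (fun p : {poly R} => p`_0) A).
by apply/matrixP => i j; rewrite !mxE -size1_polyC.
Qed.

Lemma size_det m (A : 'M[{poly R}]_m) (d : 'I_m -> nat) :
    (forall i j, (size (A i j) <= (d i).+1)%N) ->
  (size (\det A) <= (\sum_i d i).+1)%N.
Proof.
move=> Ad; apply: size_sum_deg => s _; rewrite size_Msign.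
apply: leq_trans (size_poly_prod_leq _ _) _.
rewrite cardT size_enum_ord leq_subLR addnS ltnS.
rewrite -[X in (_ <= X + _)%N]card_ord -sum1_card -big_split /=.
by apply: leq_sum => i _; rewrite add1n.
Qed.

Lemma mxdeg_minors n (M : 'M_(n, n.+1)) : mxdeg 1 M -> mxdeg n (minors M).
Proof.
move=> M1 j k; rewrite ord1 minors_det size_Msign.
rewrite -[X in (_ <= X.+1)%N]card_ord -sum1_card.
by apply: size_det => i l; rewrite mxE.
Qed.

Lemma mxdeg_syzygy n (M : 'M_(n, n.+1)) (r : 'rV_n.+1) d :
    mxdeg 1 M -> mxdeg d.+1 r ->
  mxdeg (d + n) (rsubmx (\adj (col_mx r M) : 'M_(1 + n))).
Proof.
move=> M1 rd j i; pose i1 : 'I_n.+1 := rshift 1 i.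
rewrite mxE /adjugate mxE /cofactor size_Msign.
pose deg (k : 'I_n.+1) := if k == 0 then d.+1 else 1%N.
have deg_sum : (\sum_k deg (lift i1 k) = d + n)%N.
  have := @bigD1_ord _ addn 0%N _ i1 xpredT deg isT.
  rewrite big_ord_recl {1 2}/deg /= (eq_bigr (fun=> 1%N)) // sum1_card card_ord.
  by move=> e; apply/eqP; rewrite -eqSS -[(_ + _).+1]addSn e addnC addn1.
rewrite -deg_sum; apply: size_det => k l; rewrite mxE mxE /deg -/i1.
case: (splitP (lift i1 k : 'I_(1 + n))) => [k0 k0E|k' k'E].
  have -> : lift i1 k = lshift n (0 : 'I_1) by apply: ord_inj; rewrite k0E ord1.
  by rewrite (col_mxEu r M); apply: rd.
have -> : lift i1 k = rshift 1 k' by apply: val_inj.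
by rewrite (col_mxEd r M); apply: M1.
Qed.

Lemma polyC_lreg (c : R) : GRing.lreg c -> GRing.lreg c%:P.
Proof.
move=> c_reg p q cpq; apply/polyP => i; apply: c_reg.
by rewrite -!coefCM cpq.
Qed.

Lemma mxdegXn d k r c (A : 'M_(r, c)) :
  mxdeg (d + k) ('X^k *: A) -> mxdeg d A.
Proof.
move=> XA i j; have := XA i j; rewrite mxE.
have [->|Aij0] := eqVneq (A i j) 0; first by rewrite size_poly0.
by rewrite mulrC size_mulXn // addnC -addSn leq_add2r.
Qed.

Section Generation.
Variables (n : nat) (A B : 'M[R]_(n, n.+1)).

(** The pencil x A - y B at x = 1, y = X. *)
Definition pencil r c (A B : 'M[R]_(r, c)) : 'M_(r, c) :=
  map_mx polyC A - 'X *: map_mx polyC B.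
Local Notation M := (pencil A B).
Local Notation v := (minors M).

Lemma mxdeg_pencil r c (A' B' : 'M[R]_(r, c)) : mxdeg 1 (pencil A' B').
Proof.
apply: mxdegB; first exact: mxdegW (mxdeg_polyC _).
by apply: (@mxdegZ 0 1); rewrite ?size_polyX //; apply: mxdeg_polyC.
Qed.

(** Up to the factor c, the degree n + k part of the ideal generated by the
    maximal minors is everything.  A form of degree d is represented by the
    univariate polynomial of formal degree d obtained by setting x = 1. *)
Definition generates k (c : R) : Prop :=
  forall j, (j <= n + k)%N ->
  exists2 a : 'rV_n.+1, mxdeg k a & a *m v = (c%:P * 'X^j)%:M.

(** The easy part of the Hilbert-Burch theorem: where the minors generate an
    ideal of depth two, the rows of the pencil span their syzygies.  Multiplying
    the relation of minors_syzygy by combinations of the minors equal to c and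
    to c t^(n+k) shows that the coefficients have the expected degree. *)
Lemma generates_syzygy k c d (r : 'rV_n.+1) :
    GRing.lreg c -> generates k c -> mxdeg d.+1 r -> r *m v = 0 ->
  exists2 s : 'rV_n, mxdeg d s & c%:P *: r = s *m M.
Proof.
move=> c_reg gen rd rv0.
have [a1 a1d a1v] := gen 0%N (leq0n _); rewrite expr0 mulr1 in a1v.
have [a2 a2d a2v] := gen _ (leqnn _).
pose C := - rsubmx (\adj (col_mx r M) : 'M_(1 + n)).
have Cd : mxdeg (d + n) C.
  by apply/mxdegN/mxdeg_syzygy => //; apply: mxdeg_pencil.
have vr : v *m r = C *m M by rewrite minors_syzygy // mulNmx.
have s1E : c%:P *: r = a1 *m C *m M by rewrite -mulmxA -vr mulmxA a1v mul_scalar_mx.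
have s2E : (c%:P * 'X^(n + k)) *: r = a2 *m C *m M.
  by rewrite -mulmxA -vr mulmxA a2v mul_scalar_mx.
exists (a1 *m C) => //; apply: (@mxdegXn _ (n + k)).
suff -> : 'X^(n + k) *: (a1 *m C) = a2 *m C.
  rewrite (_ : d + (n + k) = k + (d + n))%N; first exact: mxdegM.
  by lia.
have /minors_mul_ker : ('X^(n + k) *: (a1 *m C) - a2 *m C) *m M = 0.
  by rewrite mulmxBl -scalemxAl -s1E -s2E scalerA mulrC subrr.
move/(congr1 (mulmx a1)); rewrite mulmxA a1v mulmx0 mul_scalar_mx => cs0.
apply/eqP; rewrite -subr_eq0; apply/eqP.
by apply: (lreg_scalemx (polyC_lreg c_reg)); rewrite scaler0.
Qed.

(** If x F and y F are combinations a.v and b.v, then y a - x b is a syzygy,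
    that is s M.  Splitting s as y s0 + x s1 and correcting a and b by rows of
    M makes y a = x b, so a is divisible by x. *)
Lemma generates_descent l c k e :
    GRing.lreg c -> generates l c -> generates k.+1 e -> generates k (c * e).
Proof.
move=> c_reg gen_c gen_e j le_j.
have le_j1 : (j.+1 <= n + k.+1)%N by rewrite addnS.
have [a ad av] := gen_e j.+1 le_j1.
have [b bd bv] := gen_e j (ltnW le_j1).
have rd : mxdeg k.+2 (a - 'X *: b).
  apply: mxdegB; first exact: mxdegW ad.
  by apply: (@mxdegZ k.+1 1); rewrite ?size_polyX.
have rv0 : (a - 'X *: b) *m v = 0.
  rewrite mulmxBl -scalemxAl av bv scale_scalar_mx mulrCA -exprS subrr //.
have [s sd sM] := generates_syzygy c_reg gen_c rd rv0.
pose s0 := map_mx (take_poly 1) s; pose s1 := map_mx (drop_poly 1) s.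
have sE : s = s0 + 'X *: s1.
  by apply/matrixP => i i'; rewrite !mxE mulrC -{1}[s i i'](poly_take_drop 1).
have s0d : mxdeg 0 s0 by move=> i i'; rewrite mxE size_take_poly.
have s1d : mxdeg k s1.
  by move=> i i'; rewrite mxE size_drop_poly leq_subLR add1n; apply: sd.
pose b' : 'rV[{poly R}]_n.+1 := c%:P *: b + s1 *m M.
have b'X : 'X *: b' = c%:P *: a - s0 *m M.
  have -> : c%:P *: a = s *m M + 'X *: (c%:P *: b).
    by rewrite -sM scalerBr scalerA mulrC -scalerA subrK.
  rewrite sE mulmxDl -scalemxAl scalerDr.
  by rewrite [RHS]addrAC [s0 *m M + _]addrC addrK addrC.
exists b'; last first.
  rewrite mulmxDl -mulmxA mul_minors mulmx0 addr0 -scalemxAl bv.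
  by rewrite scale_scalar_mx mulrA polyCM.
apply: (@mxdegXn k 1); rewrite expr1 b'X addn1.
apply: mxdegB; first exact: mxdegZC.
by apply: mxdegW (mxdegM s0d (mxdeg_pencil _ _)).
Qed.

Lemma generates0 k c :
  GRing.lreg c -> generates k c -> exists m, generates 0 (c ^+ m).
Proof.
move=> c_reg gen; suff: forall l, (l <= k)%N -> exists m, generates (k - l) (c ^+ m).
  by move/(_ k (leqnn k)); rewrite subnn.
elim=> [|l IHl] le_lk; first by exists 1%N; rewrite subn0.
have [m gen_m] := IHl (ltnW le_lk); exists m.+1; rewrite exprS.
by apply: generates_descent c_reg gen _; rewrite -subSn.
Qed.

Definition minors_mx : 'M[R]_n.+1 := \matrix_(i, j) (v i 0)`_j.

Lemma minors_mxE : v = map_mx polyC minors_mx *m powers R n.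
Proof.
apply/matrixP => i j; rewrite ord1 [RHS]mxE.
have vd := mxdeg_minors (mxdeg_pencil A B) i 0.
apply/polyP => k; rewrite coef_sum.
under eq_bigr => l _ do rewrite [powers _ _ _ _]mxE [map_mx _ _ _ _]mxE
  [minors_mx _ _]mxE coefCM coefXn.
case: (ltnP k n.+1) => [k_n|n_k].
  rewrite (bigD1 (Ordinal k_n)) //= eqxx mulr1 big1 ?addr0 // => l.
  by rewrite -val_eqE /= => l_k; rewrite eq_sym (negPf l_k) mulr0.
rewrite nth_default ?(leq_trans vd) // big1 // => l _.
by rewrite gtn_eqF ?mulr0 // (leq_trans (ltn_ord l)).
Qed.

Lemma powers_inj r (X Y : 'M[R]_(r, n.+1)) :
  map_mx polyC X *m powers R n = map_mx polyC Y *m powers R n -> X = Y.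
Proof.
move/(congr1 trmx)/matrixP => XY; apply/matrixP => i j.
have := congr1 (fun p : {poly R} => p`_j) (XY 0 i).
rewrite !trmx_mul !map_trmx !coef_powers_mul -ltnS ltn_ord inord_val.
by rewrite !mxE.
Qed.

(** In degree n the minors must produce c^m times each monomial with constant
    coefficients, which is a left inverse of their coefficient matrix, up to c^m. *)
Lemma generates_det k c :
    GRing.lreg c -> generates k c ->
  exists m u, u * \det minors_mx = c ^+ m.
Proof.
move=> c_reg /(generates0 c_reg)[m gen]; exists (m * n.+1)%N.
have /choice[a aP] (j : 'I_n.+1) : exists a : 'rV[R]_n.+1,
    map_mx polyC a *m v = ((c ^+ m)%:P * 'X^j)%:M.
  have [|a /mxdeg_polyCP[a' ->] av] := gen j; first by rewrite addn0 -ltnS.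
  by exists a'.
pose U := \matrix_j a j; exists (\det U).
rewrite -det_mulmx exprM -det_scalar; congr (\det _); apply: powers_inj.
rewrite map_mxM -mulmxA -minors_mxE map_scalar_mx mul_scalar_mx.
apply/row_matrixP => j; rewrite row_mul -map_row rowK aP.
by apply/matrixP => i i'; rewrite !ord1 !mxE mulr1n.
Qed.

Definition sylvester_half d (p : {poly R}) : 'M[R]_(d, d + d) :=
  \matrix_(i, j) (if (i <= j <= i + d)%N then p`_(j - i) else 0).

Lemma sylvester_halfE d (p : {poly R}) : (size p <= d.+1)%N ->
  map_mx polyC (sylvester_half d p) *m \col_j 'X^j = \col_i ('X^i * p).
Proof.
move=> pd; apply/matrixP => i j0; rewrite [RHS]mxE mxE.
apply/polyP => k; rewrite coef_sum coefXnM.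
under eq_bigr => j _ do rewrite !mxE coefCM coefXn.
case: (ltnP k (d + d)) => [k_d|d_k].
  rewrite (bigD1 (Ordinal k_d)) //= eqxx mulr1 big1 ?addr0 => [|l]; last first.
    by rewrite -val_eqE /= => l_k; rewrite eq_sym (negPf l_k) mulr0.
  case: leqP => //= le_ik; case: leqP => // lt_ik.
  by rewrite nth_default // (leq_trans pd) // ltn_subRL.
rewrite big1 => [|l _]; last by rewrite gtn_eqF ?mulr0 // (leq_trans (ltn_ord l)).
have lt_id := ltn_ord i.
by case: ltnP => // le_ik; rewrite nth_default // (leq_trans pd) //; lia.
Qed.

(** Cramer's rule for the Sylvester matrix writes the resultant times any
    monomial of degree 4n - 1 as a combination of fx and fy, which are themselves
    combinations of the minors. *)
Lemma resultant_generates (fx fy : {poly R}) (a b : 'rV_n.+1) :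
    (0 < n)%N -> mxdeg n a -> mxdeg n b -> a *m v = fx%:M -> b *m v = fy%:M ->
  generates (n + n.*2).-1
    (\det (col_mx (sylvester_half n.*2 fx) (sylvester_half n.*2 fy))).
Proof.
move=> n_gt0 ad bd av bv; set S := col_mx _ _; set c := \det S.
have v_deg : mxdeg n v by apply/mxdeg_minors/mxdeg_pencil.
have size1 (u : 'rV_n.+1) f : mxdeg n u -> u *m v = f%:M -> (size f <= n.*2.+1)%N.
  move=> ud uv; have := mxdegM ud v_deg 0 0.
  by rewrite uv mxE mulr1n addnn.
pose pw : 'cV[{poly R}]_(n.*2 + n.*2) := \col_j 'X^j.
pose U : 'M[{poly R}]_(n.*2 + n.*2, n.+1) :=
  col_mx (\col_i 'X^i *m a) (\col_i 'X^i *m b).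
have US : U *m v = map_mx polyC S *m pw.
  rewrite map_col_mx !mul_col_mx (sylvester_halfE (size1 a fx ad av))
    (sylvester_halfE (size1 b fy bd bv)).
  by rewrite -!mulmxA av bv !mul_mx_scalar; congr col_mx;
    apply/matrixP => i j; rewrite !mxE mulrC.
move=> j le_j; have j_d : (j < n.*2 + n.*2)%N by lia.
exists (row (Ordinal j_d) (map_mx polyC (\adj S) *m U)).
  move=> i i'; rewrite mxE.
  have Ud : mxdeg (n + n.*2).-1 U.
    have Xd : mxdeg (n.*2).-1 (\col_(i < n.*2) 'X^i : 'cV[{poly R}]_n.*2).
      by move=> k k'; rewrite mxE size_polyXn prednK ?double_gt0.
    have -> : (n + n.*2).-1 = ((n.*2).-1 + n)%N by lia.
    rewrite /U => k k'; rewrite mxE; case: splitP => l _; exact: mxdegM.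
  exact: (mxdegM (mxdeg_polyC (\adj S)) Ud).
rewrite -row_mul -mulmxA US mulmxA -map_mxM mul_adj_mx map_scalar_mx.
by rewrite mul_scalar_mx; apply/matrixP => i i'; rewrite !ord1 !mxE mulr1n.
Qed.

End Generation.

Lemma deriv_mulmx r m c (P : 'M[{poly R}]_(r, m)) (Q : 'M_(m, c)) :
  map_mx (@deriv R) (P *m Q) = map_mx (@deriv R) P *m Q + P *m map_mx (@deriv R) Q.
Proof.
apply/matrixP => i j; rewrite !mxE raddf_sum -big_split /=.
by apply: eq_bigr => k _; rewrite derivM !mxE.
Qed.

Section Discriminant.
Variables (n : nat) (A1 B1 : 'M[R]_(n, n.+1)) (A2 B2 : 'M[R]_n.+1).
Hypotheses (A2_sym : A2^T = A2) (B2_sym : B2^T = B2).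
Local Notation v := (minors (pencil A1 B1)).
Local Notation T := (pencil A2 B2).
Local Notation dv := (map_mx (@deriv R) v).

Definition quad_form : {poly R} := (v^T *m T *m v) 0 0.
Local Notation F := quad_form.

Lemma quad_formE : v^T *m T *m v = F%:M.
Proof. by apply/matrixP => i j; rewrite !ord1 [RHS]mxE mulr1n. Qed.

Lemma pencil_sym : T^T = T.
Proof. by rewrite /pencil linearB linearZ /= !map_trmx A2_sym B2_sym. Qed.

Lemma deriv_pencil : map_mx (@deriv R) T = - map_mx polyC B2.
Proof.
apply/matrixP => i j; rewrite !mxE derivB derivM derivX !derivC.
by rewrite mul1r mulr0 addr0 sub0r.
Qed.

Lemma sym_swap (u w : 'cV[{poly R}]_n.+1) : u^T *m T *m w = w^T *m T *m u.
Proof.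
have tr11 (X : 'M[{poly R}]_1) : X = X^T.
  by apply/matrixP => i j; rewrite !ord1 mxE.
by rewrite [LHS]tr11 !trmx_mul trmxK pencil_sym mulmxA.
Qed.

(** F is quadratic in v, so its derivatives are linear combinations of v; the
    row vector is written out because its degree matters. *)
Lemma deriv_quad_form :
  (dv^T *m T *+ 2 - v^T *m map_mx polyC B2) *m v = (F^`())%:M.
Proof.
have -> : (F^`())%:M = map_mx (@deriv R) (v^T *m T *m v).
  by rewrite quad_formE; apply/matrixP => i j; rewrite !ord1 !mxE !mulr1n.
rewrite !deriv_mulmx deriv_pencil -map_trmx (sym_swap v dv).
rewrite mulmxDl mulmxBl mulmxN mulNmx mulr2n mulmxDl.
by rewrite addrAC.
Qed.

(** The companion of the previous lemma for the derivative in x, which Euler's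
    identity turns into (2n+1) F - X F' at x = 1, y = X. *)
Lemma euler_quad_form :
  (v^T *m map_mx polyC A2 + ((v *+ n - 'X *: dv)^T *m T) *+ 2) *m v
  = (F *+ n.*2.+1 - 'X * F^`())%:M.
Proof.
have TE : map_mx polyC A2 = T + 'X *: map_mx polyC B2 by rewrite subrK.
have dF : dv^T *m T *m v + dv^T *m T *m v - v^T *m map_mx polyC B2 *m v = (F^`())%:M.
  by rewrite -deriv_quad_form mulmxBl mulr2n mulmxDl.
rewrite TE.
rewrite [LHS](_ : _ = F%:M + 'X *: (v^T *m map_mx polyC B2 *m v) +
      (F%:M *+ n - 'X *: (dv^T *m T *m v)) *+ 2); last first.
  have -> : (v *+ n - 'X *: dv)^T = v^T *+ n - 'X *: dv^T.
    by rewrite linearB /= linearMn linearZ.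
  have mulMn k (u : 'rV[{poly R}]_n.+1) m (w : 'M_(n.+1, m)) : (u *+ k) *m w = (u *m w) *+ k.
    by rewrite -!scaler_nat scalemxAl.
  rewrite -quad_formE mulmxDl mulmxDr mulmxDl -scalemxAr -scalemxAl.
  by do 2!rewrite !mulmxBl !mulMn -!scalemxAl; rewrite mulr2n.
move: dF; rewrite [v^T *m _ *m v]mx11_scalar [dv^T *m _ *m v]mx11_scalar.
set b := (v^T *m _ *m v) 0 0; set c := (dv^T *m _ *m v) 0 0.
move/matrixP/(_ 0 0); rewrite !mxE !mulr1n => dF.
have nE : (F%:M *+ n : 'M[{poly R}]_1) 0 0 = F *+ n.
  by rewrite -scaler_nat !mxE mulr1n mulr_natl.
apply/matrixP => i j; rewrite !ord1 !mxE !mulr1n nE -dF -addnn -addn1 !mulrnDr.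
ring.
Qed.

Lemma size_euler m (p : {poly R}) :
  (0 < m)%N -> (size p <= m.+1)%N -> (size (p *+ m - 'X * p^`())%R <= m)%N.
Proof.
move=> m_gt0 pm; apply/leq_sizeP => k le_mk.
rewrite coefB coefMn coefXM; case: k le_mk => [|k] le_mk.
  by move: le_mk; rewrite leqNgt m_gt0.
rewrite coef_deriv /=; move: le_mk; rewrite leq_eqVlt => /predU1P[->|lt_mk].
  by rewrite subrr.
by rewrite nth_default ?mul0rn ?subrr // (leq_trans pm).
Qed.

Lemma mxdeg_euler m r c (w : 'M[{poly R}]_(r, c)) :
  (0 < m)%N -> mxdeg m w -> mxdeg m.-1 (w *+ m - 'X *: map_mx (@deriv R) w).
Proof.
move=> m_gt0 wd i j; rewrite prednK // -scaler_nat !mxE mulr_natl.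
exact: size_euler.
Qed.

Lemma mxdeg_deriv m r c (w : 'M[{poly R}]_(r, c)) :
  (0 < m)%N -> mxdeg m w -> mxdeg m.-1 (map_mx (@deriv R) w).
Proof.
move=> m_gt0 wd i j; rewrite prednK // mxE; apply/leq_sizeP => k le_mk.
by rewrite coef_deriv nth_default ?mul0rn // (leq_trans (wd i j)).
Qed.

(** The partial derivatives of F lie in the ideal of the minors.  So the
    minors generate, up to the resultant, everything in degree 4n - 1, and then
    by descent everything in degree n.  Hence the coefficient matrix of the
    minors is invertible wherever the resultant is. *)
Lemma resultant_minors_mx :
    (0 < n)%N ->
  let c := \det (col_mx (sylvester_half n.*2 (F *+ n.*2.+1 - 'X * F^`()))
                        (sylvester_half n.*2 F^`())) in
    GRing.lreg c -> exists m u, u * \det (minors_mx A1 B1) = c ^+ m.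
Proof.
move=> n_gt0 c c_reg; apply: generates_det c_reg _.
have v_deg : mxdeg n v by apply/mxdeg_minors/mxdeg_pencil.
have T_deg : mxdeg 1 T := mxdeg_pencil A2 B2.
have MnD r d (a b : 'M[{poly R}]_(1, r)) : mxdeg d a -> mxdeg d b -> mxdeg d (b + a *+ 2).
  by move=> ad bd; rewrite mulr2n; do !apply: mxdegD.
have predn1 : (n.-1 + 1)%N = n by rewrite addn1 prednK.
have vC_deg X : mxdeg n (v^T *m map_mx polyC X).
  by move: (mxdegM (mxdegT v_deg) (mxdeg_polyC X)); rewrite addn0.
have T_mul w : mxdeg n.-1 w -> mxdeg n (w^T *m T).
  by move=> /mxdegT wd; move: (mxdegM wd T_deg); rewrite predn1.
apply: (resultant_generates n_gt0 _ _ euler_quad_form deriv_quad_form).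
  by apply: MnD; [apply/T_mul/mxdeg_euler | apply: vC_deg].
rewrite addrC; apply: MnD; last exact: mxdegN.
by apply/T_mul/mxdeg_deriv.
Qed.

End Discriminant.
End Degrees.

(** * Normal form of a pencil of n x (n+1) matrices *)

Section NormalForm.
Variables (R : comNzRingType) (n : nat).
Local Notation lpad := (lpad R n).
Local Notation rpad := (rpad R n).
Local Notation powers := (powers R n).

Lemma map_pencil (S : comNzRingType) (f : {rmorphism R -> S}) r c (A B : 'M[R]_(r, c)) :
  map_mx (map_poly f) (pencil A B) = pencil (map_mx f A) (map_mx f B).
Proof.
by apply/matrixP => i j; rewrite !mxE rmorphB rmorphM /= map_polyX !map_polyC.
Qed.

Lemma map_minors_mx (S : comNzRingType) (f : {rmorphism R -> S}) (A B : 'M[R]_(n, n.+1)) :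
  map_mx f (minors_mx A B) = minors_mx (map_mx f A) (map_mx f B).
Proof.
apply/matrixP => i j; rewrite [LHS]mxE [in LHS]mxE [RHS]mxE.
rewrite -map_pencil -map_minors.
by rewrite [map_mx _ _ _ _]mxE coef_map.
Qed.

Lemma rpad_mul r (X : 'M[R]_(n.+1, r)) i j : (rpad *m X) i j = X (lift ord0 i) j.
Proof.
rewrite mxE (bigD1 (lift ord0 i)) //= big1 ?addr0 => [|k k_i]; rewrite mxE.
  by rewrite eqxx mul1r.
suff -> : (k == i.+1 :> nat) = false by rewrite mul0r.
by apply: contraNF k_i => /eqP k_i; apply/eqP/val_inj.
Qed.

Lemma lpad_mul r (X : 'M[R]_(n.+1, r)) i j :
  (lpad *m X) i j = X (widen_ord (leqnSn n) i) j.
Proof.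
rewrite mxE (bigD1 (widen_ord (leqnSn n) i)) //= big1 ?addr0 => [|k k_i]; rewrite mxE.
  by rewrite eqxx mul1r.
suff -> : (k == i :> nat) = false by rewrite mul0r.
by apply: contraNF k_i => /eqP k_i; apply/eqP/val_inj.
Qed.

Lemma rpad_tr : rpad *m rpad^T = 1%:M.
Proof. by apply/matrixP => i j; rewrite rpad_mul !mxE eqSS. Qed.

Lemma rpad_inj r : injective (fun X : 'M[R]_(r, n) => X *m rpad).
Proof. by move=> X Y /(congr1 (mulmx^~ rpad^T)); rewrite -!mulmxA rpad_tr !mulmx1. Qed.

Lemma pencilMl r m c (K : 'M[R]_(r, m)) (A B : 'M_(m, c)) :
  pencil (K *m A) (K *m B) = map_mx polyC K *m pencil A B.
Proof. by rewrite /pencil mulmxBr -scalemxAr !map_mxM. Qed.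

Lemma pencilMr r m c (K : 'M[R]_(m, c)) (A B : 'M_(r, m)) :
  pencil (A *m K) (B *m K) = pencil A B *m map_mx polyC K.
Proof. by rewrite /pencil mulmxBl -scalemxAl !map_mxM. Qed.

Lemma coef_mul_powers r (A : 'M[R]_(r, n.+1)) i k :
  ((map_mx polyC A *m powers) i 0)`_k = if (k <= n)%N then A i (inord k) else 0.
Proof.
have -> : (map_mx polyC A *m powers) i 0 = (powers^T *m map_mx polyC A^T) 0 i.
  by rewrite -map_trmx -trmx_mul [RHS]mxE.
by rewrite coef_powers_mul mxE.
Qed.

(** The relation says that the columns of A are those of B shifted by one
    place, and that the first column of A and the last one of B vanish. *)
Lemma powers_syzygy r (A B : 'M[R]_(r, n.+1)) :
  pencil A B *m powers = 0 -> exists g, A = g *m rpad /\ B = g *m lpad.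
Proof.
rewrite /pencil mulmxBl -scalemxAl => /eqP; rewrite subr_eq0 => /eqP AB.
have AB_coef i k : (if (k <= n)%N then A i (inord k) else 0) =
    if k is k'.+1 then if (k' <= n)%N then B i (inord k') else 0 else 0.
  by rewrite -coef_mul_powers AB mxE coefXM; case: k => //= k; rewrite coef_mul_powers.
exists (\matrix_(i, j) A i (lift ord0 j)); split; apply/matrixP => i j.
  case: (unliftP ord0 j) => [j' ->|->]; first by rewrite (@mul_rpad _ _ _ _ _ _ j') // mxE.
  rewrite (_ : ord0 = 0) ?mul_rpad0; last exact: val_inj.
  by rewrite -[RHS](AB_coef i 0%N) /=; congr (A i _); apply: val_inj; rewrite /= inordK.
case: (ltnP j n) => [j_n|n_j].
  rewrite (@mul_lpad _ _ _ _ _ _ (Ordinal j_n)) // mxE.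
  have := AB_coef i j.+1; rewrite j_n -ltnS ltnW //= inord_val => <-.
  by congr (A i _); apply: val_inj; rewrite /= inordK.
have jn : j = ord_max by apply/val_inj/eqP; rewrite /= eqn_leq n_j -ltnS ltn_ord.
rewrite jn mul_lpad_max.
have := AB_coef i n.+1; rewrite ltnn leqnn => ->.
by congr (B i _); apply: val_inj; rewrite /= inordK.
Qed.

End NormalForm.

Lemma pencil_padE (R : comNzRingType) n :
  pencil (rpad R n) (lpad R n) = rpad {poly R} n - 'X *: lpad {poly R} n.
Proof. by congr (_ - _ *: _); apply/matrixP => i j; rewrite !mxE rmorph_nat. Qed.

Section MinorsPad.
Variables (R : comNzRingType) (n : nat).
Local Notation L := (pencil (rpad R n) (lpad R n)).

Lemma pencil_pad_mul (u : 'cV[{poly R}]_n.+1) i :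
  (L *m u) i 0 = u (lift ord0 i) 0 - 'X * u (widen_ord (leqnSn n) i) 0.
Proof.
by rewrite pencil_padE mulmxBl -scalemxAl [LHS]mxE rpad_mul mxE [in LHS]mxE lpad_mul.
Qed.

Lemma pencil_pad_powers : L *m powers R n = 0.
Proof.
apply/matrixP => i j; rewrite ord1 pencil_pad_mul !mxE /=.
by rewrite -exprS subrr.
Qed.

Lemma minors_pad : minors L = powers R n.
Proof.
have w0 : minors L 0 0 = 1.
  rewrite minors_det expr0 mul1r det_trig => [|].
    rewrite big1 // => i _.
    by rewrite pencil_padE !mxE eqxx /bump /= gtn_eqF // mulr0 subr0.
  apply/is_trig_mxP => i j lt_ij; rewrite pencil_padE !mxE /= /bump /= add1n eqSS.
  by rewrite !gtn_eqF // ?mulr0 ?subr0 // ltnW.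
suff wE m : forall j : 'I_n.+1, j = m :> nat -> minors L j 0 = 'X^m.
  by apply/matrixP => j k; rewrite ord1 [RHS]mxE; apply: wE.
elim: m => [|m IHm] j jm.
  by rewrite (_ : j = 0) ?w0 //; apply: val_inj.
have m_n : (m < n)%N by rewrite -ltnS -jm ltn_ord.
have := pencil_pad_mul (minors L) (Ordinal m_n).
rewrite mul_minors [LHS]mxE (IHm (widen_ord _ _)) // -exprS => /esym/eqP.
rewrite subr_eq0 => /eqP <-; congr (minors L _ _); exact: val_inj.
Qed.

End MinorsPad.

Section LocalNormalForm.
Variables (R : comNzRingType) (n : nat).
Local Notation lpad := (lpad R n).
Local Notation rpad := (rpad R n).
Local Notation powers := (powers R n).

Lemma pencil_minors_mx (A B : 'M[R]_(n, n.+1)) :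
  pencil (A *m minors_mx A B) (B *m minors_mx A B) *m powers = 0.
Proof. by rewrite pencilMr -mulmxA -minors_mxE mul_minors. Qed.

(** The pencil kills its minors V *m powers, so after multiplication by V its
    rows are linear syzygies of the powers.  Comparing minors of both sides
    gives the equality of determinants. *)
Lemma normal_form (A B : 'M[R]_(n, n.+1)) :
    let V := minors_mx A B in GRing.lreg (\det V) ->
  exists g, [/\ A *m V = g *m rpad, B *m V = g *m lpad & \det g = \det V].
Proof.
move=> V V_reg; have [g [gA gB]] := powers_syzygy (pencil_minors_mx A B).
exists g; split=> //.
have := minors_mul (pencil A B) 1%:M (map_mx polyC V).
rewrite mul1mx -pencilMr gA gB pencilMl -[map_mx polyC g *m _]mulmx1.
have := minors_mul (pencil rpad lpad) (map_mx polyC g) 1%:M.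
rewrite mul1mx => ->; rewrite !det1 mulr1 mul1r minors_pad minors_mxE -/V.
rewrite -scalemxAr !det_map_mx -!mul_scalar_mx -!map_scalar_mx !mulmxA -!map_mxM.
move/powers_inj; rewrite !mul_scalar_mx => gV.
have : (\det g *: V) *m \adj V = (\det V *: V) *m \adj V by rewrite gV.
rewrite -!scalemxAl mul_mx_adj !scale_scalar_mx.
move/matrixP/(_ 0 0); rewrite !mxE !mulr1n => gV00.
by apply: V_reg; rewrite mulrC gV00.
Qed.

Variables (A B A' B' : 'M[R]_(n, n.+1)) (k1 : 'M[R]_n) (k2 : 'M[R]_n.+1).
Hypothesis det_k : \det k1 * \det k2 = 1.
Hypotheses (A'E : A' = k1 *m A *m k2^T) (B'E : B' = k1 *m B *m k2^T).

Lemma minors_mx_equiv : k2^T *m minors_mx A' B' = minors_mx A B.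
Proof.
apply: powers_inj; rewrite map_mxM -mulmxA.
transitivity (map_mx polyC k2^T *m minors (pencil A' B')).
  by congr (_ *m _); rewrite minors_mxE.
transitivity (minors (pencil A B)); last exact: minors_mxE.
rewrite A'E B'E.
rewrite pencilMr pencilMl minors_mul !det_map_mx det_tr -polyCM det_k.
by rewrite scale1r.
Qed.

End LocalNormalForm.

(** The lower left block w of a group element changes the normalized diagonal
    block V^T *m A2 *m V by the symmetrization of W *m P with W = V'^T *m w *m g. *)
Lemma quad_equiv (R : comNzRingType) n (X P : 'M[R]_(n, n.+1)) (g : 'M_n)
    (k2 V V' A2 : 'M[R]_n.+1) (w : 'M_(n.+1, n)) :
    k2^T *m V' = V -> X *m V = g *m P ->
  V'^T *m (k2 *m A2 *m k2^T + w *m X *m k2^T + k2 *m X^T *m w^T) *m V' =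
  V^T *m A2 *m V + (V'^T *m w *m g *m P + (V'^T *m w *m g *m P)^T).
Proof.
move=> VE gP.
have VET : V'^T *m k2 = V^T by rewrite -VE trmx_mul trmxK.
rewrite !mulmxDr !mulmxDl -addrA; congr (_ + (_ + _)).
- by rewrite !mulmxA VET -!mulmxA VE.
- by rewrite -!mulmxA VE gP.
by rewrite -(mulmxA _ g P) -gP !trmx_mul trmxK !mulmxA VET.
Qed.

(** * Uniqueness: local equivalences glue *)

Local Notation toZp p := (map_mx (intr : int -> padic p)).

Lemma padic_det_lreg p n (A : 'M[int]_n) :
  prime p -> \det A != 0 -> GRing.lreg (\det (toZp p A)).
Proof. by move=> p_pr A0; rewrite det_map_mx; apply: padic_intr_lreg. Qed.

Lemma toZp_inj p m n : prime p -> injective (fun A : 'M[int]_(m, n) => toZp p A).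
Proof.
move=> p_pr A B /matrixP AB; apply/matrixP => i j.
by have := AB i j; rewrite !mxE => /(padic_intr_inj p_pr).
Qed.

Lemma det_adj_neq0 m (U : 'M[int]_m) : \det U != 0 -> \det (\adj U) != 0.
Proof.
move=> U0; have := congr1 determinant (mul_mx_adj U).
rewrite det_mulmx det_scalar => e.
by apply: contra_neq (expf_neq0 m U0) => adj0; rewrite -e adj0 mulr0.
Qed.

(** The rational solution adj U * C * adj V / (det U * det V) is unique, so at
    each prime it coincides with the local solution, and has no denominator. *)
Lemma solve_local m n (U : 'M[int]_m) (V : 'M[int]_n) (C : 'M[int]_(m, n)) :
    \det U != 0 -> \det V != 0 ->
    (forall p, prime p -> exists X, toZp p U *m X *m toZp p V = toZp p C) ->
  exists X, U *m X *m V = C.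
Proof.
move=> U0 V0 loc; have UV0 : \det U * \det V != 0 by rewrite mulf_neq0.
have [p p_pr|X CX] := @dvd_mx_local _ _ _ (\adj U *m C *m \adj V) UV0.
  have [X UXV] := loc p p_pr; exists X.
  rewrite !map_mxM -UXV !mulmxA -map_mxM mul_adj_mx -!mulmxA -map_mxM mul_mx_adj.
  rewrite !map_scalar_mx mul_scalar_mx mul_mx_scalar intrM.
  by rewrite scalerA.
exists X.
apply: (mulmx_det_inj (X := \adj V)).
  exact/mulfI/det_adj_neq0.
apply: (mulmx_det_injl (X := \adj U)).
  exact/mulfI/det_adj_neq0.
rewrite !mulmxA mul_adj_mx CX -!mulmxA mul_mx_adj mul_scalar_mx mul_mx_scalar.
by rewrite scalerA.
Qed.

(** At the primes that do not divide c, q is a unit; at the finitely many others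
    one exponent serves for all. *)
Lemma padic_dvd_pow (c : int) (q : forall p, padic p) :
    c != 0 ->
    (forall p, prime p -> exists m u, u * q p = (c%:~R) ^+ m) ->
  exists2 D : int, D != 0 & forall p, prime p -> exists u, u * q p = D%:~R.
Proof.
move=> c0 qc.
have /choice[m mP] p : exists m : nat, prime p -> exists u, u * q p = (c%:~R) ^+ m.
  by case: (boolP (prime p)) => [/qc[m mP]|_]; [exists m | exists 0%N].
pose E := (\sum_(p < `|c|.+1) m p)%N; exists (c ^+ E).
  exact: expf_neq0.
move=> p p_pr; have [u uq] := mP p p_pr.
case: (ltnP p `|c|.+1) => [lt_p|lt_c].
  have le_E : (m p <= E)%N by rewrite /E (bigD1 (Ordinal lt_p)) //= leq_addr.
  exists (c%:~R ^+ (E - m p) * u).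
  by rewrite -mulrA uq -exprD subnK // rmorphXn.
have co_c : coprime `|c|%N p.
  rewrite coprime_sym prime_coprime //; apply/negP => /dvdn_leq.
  by rewrite absz_gt0 c0 leqNgt => /(_ isT) /negP; apply.
have [y cy] := padic_coprime_unit p_pr co_c.
have [z cz] : exists z : padic p, c%:~R * z = 1.
  case: (c) cy => k /= cy; first by exists y.
  by exists (- y); rewrite NegzE mulrN rmorphN mulNr opprK.
exists (z ^+ m p * u * (c ^+ E)%:~R).
rewrite mulrAC -[_ * u * _]mulrA uq -exprMn [z * _]mulrC cz expr1n mul1r //.
Qed.

Lemma map_poly_inj_padic p (P : {poly int}) :
  prime p -> map_poly (intr : int -> padic p) P = 0 -> P = 0.
Proof.
move=> p_pr /polyP P0; apply/polyP => i; apply: (padic_intr_inj p_pr).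
by rewrite -coef_map P0 !coef0.
Qed.

Section Equivalence.
Variables (R : comNzRingType) (n : nat).

(** The action of a block lower triangular matrix with diagonal blocks k1, k2
    and lower block w on a symmetric matrix with blocks 0, X, X^T, Y. *)
Definition act_off (k1 : 'M[R]_n) (k2 : 'M[R]_n.+1) (X : 'M[R]_(n, n.+1)) :=
  k1 *m X *m k2^T.

Definition act_diag (k2 : 'M[R]_n.+1) (w : 'M[R]_(n.+1, n))
    (X : 'M[R]_(n, n.+1)) (Y : 'M[R]_n.+1) :=
  k2 *m Y *m k2^T + w *m X *m k2^T + k2 *m X^T *m w^T.

Definition block_equiv (A1 B1 A1' B1' : 'M[R]_(n, n.+1))
    (A2 B2 A2' B2' : 'M[R]_n.+1) : Prop :=
  exists k1 k2 w, [/\ \det k1 * \det k2 = 1,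
    A1' = act_off k1 k2 A1 /\ B1' = act_off k1 k2 B1
  & A2' = act_diag k2 w A1 A2 /\ B2' = act_diag k2 w B1 B2].

Lemma sym_pencil_vanish (W : 'M[R]_(n.+1, n)) :
  (powers R n)^T *m pencil (W *m rpad R n + (W *m rpad R n)^T)
                           (W *m lpad R n + (W *m lpad R n)^T) *m powers R n = 0.
Proof.
have -> : pencil (W *m rpad R n + (W *m rpad R n)^T)
                 (W *m lpad R n + (W *m lpad R n)^T) =
    map_mx polyC W *m pencil (rpad R n) (lpad R n)
    + (map_mx polyC W *m pencil (rpad R n) (lpad R n))^T.
  rewrite -pencilMl /pencil !map_mxD scalerDr opprD addrACA [in RHS]linearB /=.
  by rewrite [('X *: _)^T]linearZ /= !map_trmx.
rewrite mulmxDr mulmxDl -!mulmxA pencil_pad_powers !mulmx0 add0r.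
by rewrite mulmxA -trmx_mul -!mulmxA pencil_pad_powers !mulmx0 trmx0 mul0mx.
Qed.

End Equivalence.

Lemma sqr_tr_sym (R : comNzRingType) n (V A : 'M[R]_n) :
  A^T = A -> (V^T *m A *m V)^T = V^T *m A *m V.
Proof. by move=> A_sym; rewrite !trmx_mul trmxK A_sym mulmxA. Qed.

Lemma map_pad (R S : comNzRingType) (f : {rmorphism R -> S}) n :
  (map_mx f (rpad R n) = rpad S n) * (map_mx f (lpad R n) = lpad S n).
Proof. by split; apply/matrixP => i j; rewrite !mxE rmorph_nat. Qed.

Lemma map_quad_powers (R S : comNzRingType) (f : {rmorphism R -> S}) n
    (A B : 'M[R]_n.+1) :
  map_poly f (((powers R n)^T *m pencil A B *m powers R n) 0 0) =
  ((powers S n)^T *m pencil (map_mx f A) (map_mx f B) *m powers S n) 0 0.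
Proof.
have powE : map_mx (map_poly f) (powers R n) = powers S n.
  by apply/matrixP => i j; rewrite !mxE map_polyXn.
by rewrite -powE -map_pencil map_trmx -!map_mxM [RHS]mxE.
Qed.

(** The blocks k1, k2 and w of the local equivalences solve linear equations
    with integer coefficients and at most one solution, so at all primes they
    are the images of the same integer matrices. *)
Lemma block_equiv_local_global n (A1 B1 A1' B1' : 'M[int]_(n, n.+1))
    (A2 B2 A2' B2' : 'M[int]_n.+1) (g g' : 'M_n) (V V' : 'M_n.+1) :
    A2^T = A2 -> B2^T = B2 -> A2'^T = A2' -> B2'^T = B2' ->
    A1 *m V = g *m rpad _ n -> B1 *m V = g *m lpad _ n ->
    A1' *m V' = g' *m rpad _ n -> B1' *m V' = g' *m lpad _ n ->
    \det g != 0 -> \det V != 0 -> \det V' != 0 ->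
    (forall p, prime p -> exists k1 k2 w, [/\ \det k1 * \det k2 = 1,
        toZp p A1' = act_off k1 k2 (toZp p A1)
        /\ toZp p B1' = act_off k1 k2 (toZp p B1),
        toZp p A2' = act_diag k2 w (toZp p A1) (toZp p A2)
        /\ toZp p B2' = act_diag k2 w (toZp p B1) (toZp p B2)
      & k2^T *m toZp p V' = toZp p V]) ->
  block_equiv A1 B1 A1' B1' A2 B2 A2' B2'.
Proof.
move=> A2s B2s A2's B2's gA gB gA' gB' g0 V0 V'0 loc.
have d1 m : \det (1%:M : 'M[int]_m) != 0 by rewrite det1; exact: oner_neq0.
have V'T0 : \det V'^T != 0 by rewrite det_tr.
have padE p := @map_pad int (padic p) intr n.
have map_gP p : (toZp p A1 *m toZp p V = toZp p g *m rpad _ n) *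
    (toZp p B1 *m toZp p V = toZp p g *m lpad _ n).
  by rewrite -!(padE p) -!map_mxM gA gB.
have map_gP' p : toZp p A1' *m toZp p V' = toZp p g' *m rpad _ n.
  by rewrite -!(padE p) -!map_mxM gA'.
have k1g p k1 k2 : toZp p A1' = act_off k1 k2 (toZp p A1) ->
    k2^T *m toZp p V' = toZp p V -> k1 *m toZp p g = toZp p g'.
  move=> eA eV; apply: rpad_inj; rewrite /= -map_gP' eA /act_off.
  by rewrite -[RHS]mulmxA eV -!mulmxA map_gP.
have [p p_pr|K1 K1g] := @solve_local _ _ 1%:M g g' (d1 _) g0.
  have [k1 [k2 [w [_ [eA _] _ eV]]]] := loc p p_pr.
  by exists k1; rewrite map_mx1 mul1mx (k1g p k1 k2).
have [p p_pr|K2 K2V] := @solve_local _ _ 1%:M V' V (d1 _) V'0.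
  have [k1 [k2 [w [_ [eA _] _ eV]]]] := loc p p_pr.
  by exists k2^T; rewrite map_mx1 mul1mx.
rewrite mul1mx in K1g; rewrite mul1mx in K2V.
pose QA := V'^T *m A2' *m V' - V^T *m A2 *m V.
pose QB := V'^T *m B2' *m V' - V^T *m B2 *m V.
have QE p k1 k2 w : toZp p A2' = act_diag k2 w (toZp p A1) (toZp p A2) ->
     toZp p B2' = act_diag k2 w (toZp p B1) (toZp p B2) ->
     toZp p A1' = act_off k1 k2 (toZp p A1) ->
     k2^T *m toZp p V' = toZp p V ->
   let Y := (toZp p V')^T *m w *m toZp p g in
   toZp p QA = Y *m rpad _ n + (Y *m rpad _ n)^T /\
   toZp p QB = Y *m lpad _ n + (Y *m lpad _ n)^T.
  move=> eA eB eA1 eV Y; rewrite /QA /QB !map_mxB !map_mxM -!map_trmx eA eB.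
  have eqA := quad_equiv (toZp p A2) w eV (map_gP p).1.
  have eqB := quad_equiv (toZp p B2) w eV (map_gP p).2.
  have addBK (X Z : 'M[padic p]_n.+1) : X + Z - X = Z by rewrite addrAC subrr add0r.
  by split; [apply: etrans (congr1 (fun M => M - _) eqA) (addBK _ _)
            |apply: etrans (congr1 (fun M => M - _) eqB) (addBK _ _)].
have QA_sym : QA^T = QA by rewrite /QA linearB /= !sqr_tr_sym.
have QB_sym : QB^T = QB by rewrite /QB linearB /= !sqr_tr_sym.
(* Any local equivalence shows that the pencil (QA, QB) vanishes on the powers. *)
have [|Y [YA YB]] := symmetric_pencil_sol QA_sym QB_sym.
  have [k1 [k2 [w [_ [eA _] [eA2 eB2] eV]]]] := loc 2 isT.
  apply: (@map_poly_inj_padic 2) => //.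
  rewrite map_quad_powers; have [-> ->] := QE _ _ _ _ eA2 eB2 eA eV.
  by rewrite sym_pencil_vanish mxE.
have Yw p k1 k2 w : prime p -> toZp p A2' = act_diag k2 w (toZp p A1) (toZp p A2) ->
     toZp p B2' = act_diag k2 w (toZp p B1) (toZp p B2) ->
     toZp p A1' = act_off k1 k2 (toZp p A1) ->
     k2^T *m toZp p V' = toZp p V -> (toZp p V')^T *m w *m toZp p g = toZp p Y.
  move=> p_pr eA eB eA1 eV; have [wA wB] := QE _ _ _ _ eA eB eA1 eV.
  have symB (X Z : 'M[padic p]_(n.+1, n)) P : (X - Z) *m P + ((X - Z) *m P)^T =
      X *m P + (X *m P)^T - (Z *m P + (Z *m P)^T).
    by rewrite mulmxBl [(_ - _)^T]linearB /= addrACA -opprD.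
  apply/eqP; rewrite -subr_eq0; apply/eqP; apply: symmetric_pencil_sol0.
    by rewrite symB -wA YA map_mxD -map_trmx map_mxM padE subrr.
  by rewrite symB -wB YB map_mxD -map_trmx map_mxM padE subrr.
have [p p_pr|W WY] := @solve_local _ _ V'^T g Y V'T0 g0.
  have [k1 [k2 [w [_ [eA _] [eA2 eB2] eV]]]] := loc p p_pr.
  by exists w; rewrite -map_trmx (Yw p k1 k2).
have [k1 [k2 [w [det_k [eA eB] [eA2 eB2] eV]]]] := loc 2 isT.
have k1E : k1 = toZp 2 K1.
  apply: (mulmx_det_inj (padic_det_lreg (isT : prime 2) g0)).
  by rewrite (k1g _ _ _ eA eV) -map_mxM K1g.
have k2E : k2 = toZp 2 K2^T.
  rewrite -map_trmx -[k2]trmxK; congr (_^T).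
  apply: (mulmx_det_inj (padic_det_lreg (isT : prime 2) V'0)).
  by rewrite eV -map_mxM K2V.
have wE : w = toZp 2 W.
  apply: (mulmx_det_inj (padic_det_lreg (isT : prime 2) g0)).
  apply: (mulmx_det_injl (padic_det_lreg (isT : prime 2) V'T0)).
  rewrite !mulmxA -map_trmx (Yw 2 k1 k2 w isT eA2 eB2 eA eV) map_trmx -!map_mxM.
  by rewrite WY.
move: det_k eA eB eA2 eB2; rewrite k1E k2E wE => det_k eA eB eA2 eB2.
exists K1, K2^T, W; split.
- apply: (@padic_intr_inj 2 isT); rewrite rmorphM rmorph1 -!det_map_mx //.
- split; apply: (@toZp_inj 2) => //=.
    by rewrite eA /act_off !map_mxM map_trmx.
  by rewrite eB /act_off !map_mxM map_trmx.
split; apply: (@toZp_inj 2) => //=.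
  by rewrite eA2 /act_diag !map_mxD !map_mxM !map_trmx.
by rewrite eB2 /act_diag !map_mxD !map_mxM !map_trmx.
Qed.

(** * Existence: gluing local data *)

Lemma sum_double (V : nmodType) (h : nat -> V) m :
  \sum_(k < m.*2) h k = \sum_(i < m) (h i.*2 + h i.*2.+1).
Proof.
elim: m => [|m IHm]; first by rewrite !big_ord0.
by rewrite doubleS !big_ord_recr /= IHm addrA.
Qed.

(** The i-th diagonal entry takes care of the coefficients of X^(2i) and
    X^(2i+1). *)
Lemma diag_pencil_form (R : comNzRingType) n (F : {poly R}) :
    (size F <= n.+1.*2)%N ->
  exists A B : 'M[R]_n.+1, [/\ A^T = A, B^T = B &
    ((powers R n)^T *m pencil A B *m powers R n) 0 0 = F].
Proof.
move=> F_size; pose A : 'M[R]_n.+1 := diag_mx (\row_i F`_(i.*2)).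
pose B : 'M[R]_n.+1 := - diag_mx (\row_i F`_(i.*2.+1)).
exists A, B; split; rewrite ?linearN /= ?tr_diag_mx //.
have diagE (d : 'rV[R]_n.+1) :
    ((powers R n)^T *m map_mx polyC (diag_mx d) *m powers R n) 0 0 =
    \sum_i d 0 i *: 'X^(i.*2).
  rewrite map_diag_mx -mulmxA mul_diag_mx mxE; apply: eq_bigr => i _.
  by rewrite !mxE -mul_polyC mulrCA -exprD addnn.
rewrite /pencil map_mxN scalerN opprK mulmxDr mulmxDl -scalemxAr -scalemxAl.
rewrite mxE [X in _ + X]mxE !diagE mulr_sumr -big_split /=.
rewrite -[RHS](take_poly_id F_size) /take_poly poly_def
  (sum_double (fun i => F`_i *: 'X^i) n.+1).
by apply: eq_bigr => i _; rewrite !mxE -scalerAr -exprS.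
Qed.

Lemma det_neg_involution n : exists E : 'M[int]_n.+1, E *m E = 1%:M /\ \det E = -1.
Proof.
exists (diag_mx (\row_i (if i == 0 then -1 else 1))); split.
  rewrite mulmx_diag -diag_const_mx; congr diag_mx; apply/matrixP => i j.
  by rewrite !mxE; case: eqP => _; rewrite ?mulrNN mulr1.
rewrite det_diag big_ord_recl !mxE eqxx big1 ?mulr1 // => i _.
by rewrite mxE.
Qed.

(** The two lattices have the same index at each prime, so their integer bases
    have the same determinant up to sign, and a reflection corrects the sign.
    Equality is needed for the gluing matrices to have determinant 1. *)
Lemma local_lattice_pair n (D : int) (g : forall p, 'M[padic p]_n)
    (V : forall p, 'M[padic p]_n.+1) :
    D != 0 ->
    (forall p, prime p -> \det (g p) = \det (V p) /\
       exists u, u * \det (V p) = D%:~R) ->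
  exists (g0 : 'M[int]_n) (V0 : 'M[int]_n.+1),
    [/\ \det g0 = \det V0, \det V0 != 0 &
     forall p, prime p -> exists k k' m m',
       [/\ g p = k *m toZp p g0, k *m k' = 1%:M,
           V p = m *m toZp p V0, m *m m' = 1%:M & \det k = \det m]].
Proof.
move=> D0 gV.
have [p p_pr|g0 g0P] := @local_lattice_basis n D g D0.
  have [det_g [u uD]] := gV p p_pr; exists (u *: \adj (g p)).
  by rewrite -scalemxAl mul_adj_mx det_g scale_scalar_mx uD.
have [p p_pr|V0 V0P] := @local_lattice_basis n.+1 D V D0.
  have [_ [u uD]] := gV p p_pr; exists (u *: \adj (V p)).
  by rewrite -scalemxAl mul_adj_mx scale_scalar_mx uD.
have det_loc p : prime p -> exists a a' : padic p, a * a' = 1 /\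
    (\det g0)%:~R * a = (\det V0)%:~R.
  move=> p_pr; have [k [k' [gk kk']]] := g0P p p_pr.
  have [m [m' [Vm mm']]] := V0P p p_pr.
  have [det_gV _] := gV p p_pr.
  have dk : \det k * \det k' = 1 by rewrite -det_mulmx kk' det1.
  have dm : \det m * \det m' = 1 by rewrite -det_mulmx mm' det1.
  have e : \det k * \det (toZp p g0) = \det m * \det (toZp p V0).
    by rewrite -!det_mulmx -gk -Vm.
  exists (\det k * \det m'), (\det m * \det k'); split.
    by rewrite -[RHS]mulr1 -{1}dk -dm; ring.
  rewrite -!det_map_mx mulrA [_ * \det k]mulrC e mulrAC dm mul1r //.
have V0_neq0 : \det V0 != 0.
  apply/eqP => V00.
  have [m [m' [Vm mm']]] := V0P 2 isT; have [_ [u uD]] := gV 2 isT.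
  case/eqP: D0; apply: (@padic_intr_inj 2 isT).
  by rewrite -uD Vm det_mulmx det_map_mx V00 !mulr0.
have g0_neq0 : \det g0 != 0.
  apply: contra_neq V0_neq0 => g00; apply: (@padic_intr_inj 2 isT).
  by have [a [a' [_ <-]]] := det_loc 2 isT; rewrite g00 mul0r.
have [b Vb] : exists b, \det V0 = \det g0 * b.
  apply: dvdz_local => // p p_pr; have [a [a' [_ <-]]] := det_loc p p_pr.
  by exists a.
have [c gc] : exists c, \det g0 = \det V0 * c.
  apply: dvdz_local => // p p_pr; have [a [a' [aa' <-]]] := det_loc p p_pr.
  by exists a'; rewrite -mulrA aa' mulr1.
have {b Vb c gc} [V1 [E [V0E EE det_V1]]] : exists V1 E : 'M[int]_n.+1,
    [/\ V0 = E *m V1, E *m E = 1%:M & \det g0 = \det V1].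
  have cb : c * b = 1.
    by apply: (mulfI V0_neq0); rewrite mulrA -gc -Vb mulr1.
  case/orP: (intUnitRing.unitzPl cb) => /eqP bE.
    by exists V0, 1%:M; rewrite !mul1mx Vb bE mulr1.
  have [E [EE detE]] := det_neg_involution n.
  exists (E *m V0), E; rewrite mulmxA EE mul1mx det_mulmx detE Vb bE.
  by rewrite mulrN1 mulrN mulN1r opprK.
have V1_neq0 : \det V1 != 0 by rewrite -det_V1.
exists g0, V1; split=> // p p_pr.
have [k [k' [gk kk']]] := g0P p p_pr; have [m [m' [Vm mm']]] := V0P p p_pr.
exists k, k', (m *m toZp p E), (toZp p E *m m'); split=> //.
- by rewrite Vm V0E map_mxM mulmxA.
- by rewrite mulmxA -(mulmxA m) -map_mxM EE map_mx1 mulmx1.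
apply: (padic_det_lreg p_pr V1_neq0).
have [e _] := gV p p_pr; move: e; rewrite gk Vm V0E map_mxM mulmxA.
rewrite ![\det (_ *m toZp p _)]det_mulmx !det_map_mx det_V1 => e.
by rewrite mulrC e mulrC.
Qed.

Lemma pencilB (R : comNzRingType) m n (A B C D : 'M[R]_(m, n)) :
  pencil (A - B) (C - D) = pencil A C - pencil B D.
Proof. by rewrite /pencil !map_mxB scalerBr !opprD !opprK addrACA. Qed.

Section DiagonalBlock.
Variables (R : comNzRingType) (n : nat) (V0 V m C S : 'M[R]_n.+1).
Variables (X P : 'M[R]_(n, n.+1)) (g0 : 'M[R]_n) (W W0 y : 'M[R]_(n.+1, n)).
Hypotheses (VE : V = m *m V0) (XV : X *m V0 = g0 *m P).
Hypothesis CE : V^T *m C *m V = S + (W *m P + (W *m P)^T).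
Hypothesis W0E : W0 = W + V0^T *m y *m g0.

(** Moving W by V0^T *m y *m g0 amounts to acting by the lower left block y. *)
Lemma diag_block_eq :
  V0^T *m (m^T *m C *m m + (y *m X + (y *m X)^T)) *m V0
  = S + (W0 *m P + (W0 *m P)^T).
Proof.
have -> : S + (W0 *m P + (W0 *m P)^T) = V^T *m C *m V +
    (V0^T *m y *m g0 *m P + (V0^T *m y *m g0 *m P)^T).
  rewrite W0E CE mulmxDl [(_ + _)^T]linearD /=.
  by rewrite [in LHS]addrACA; apply: addrA.
rewrite VE !mulmxDr !mulmxDl -!mulmxA -XV; congr (_ + (_ + _)).
  by rewrite trmx_mul mulmxA.
by rewrite !trmx_mul trmxK !mulmxA.
Qed.

Lemma diag_block_local (m' X2 : 'M[R]_n.+1) :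
    GRing.lreg (\det V0) -> m *m m' = 1%:M ->
    V0^T *m X2 *m V0 = S + (W0 *m P + (W0 *m P)^T) ->
  C = act_diag m'^T (- (m'^T *m y)) X X2.
Proof.
move=> V0_reg mm' X2E.
have V0T_reg : GRing.lreg (\det V0^T) by rewrite det_tr.
have X2C : X2 = m^T *m C *m m + (y *m X + (y *m X)^T).
  apply: (mulmx_det_injl V0T_reg); apply: (mulmx_det_inj V0_reg).
  by rewrite X2E diag_block_eq.
have mT : m'^T *m m^T = 1%:M by rewrite -trmx_mul mm' trmx1.
have -> : act_diag m'^T (- (m'^T *m y)) X X2 =
    m'^T *m (X2 - (y *m X + (y *m X)^T)) *m m'^T^T.
  rewrite /act_diag mulmxBr mulmxBl mulmxDr mulmxDl opprD addrA.
  congr (_ + _ + _); first by rewrite !mulNmx !mulmxA.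
  by rewrite [(- _)^T]linearN /= mulmxN !trmx_mul !mulmxA.
by rewrite X2C addrK trmxK !mulmxA mT mul1mx -mulmxA mm' mulmx1.
Qed.

End DiagonalBlock.

(** The lattices of the local matrices g p and V p determine the off-diagonal
    blocks.  The diagonal ones are determined by matrices W p, which matter only
    modulo V0^T *m y *m g0, so that an integer approximation can replace them. *)
Lemma block_exists n (F : {poly int}) (D : int)
    (A1 B1 : forall p, 'M[padic p]_(n, n.+1))
    (A2 B2 V : forall p, 'M[padic p]_n.+1) (g : forall p, 'M[padic p]_n) :
    (size F <= n.+1.*2)%N -> D != 0 ->
    (forall p, prime p ->
       [/\ (A2 p)^T = A2 p /\ (B2 p)^T = B2 p,
           A1 p *m V p = g p *m rpad _ n /\ B1 p *m V p = g p *m lpad _ n,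
           \det (g p) = \det (V p), exists u, u * \det (V p) = D%:~R
         & ((powers _ n)^T *m pencil ((V p)^T *m A2 p *m V p)
              ((V p)^T *m B2 p *m V p) *m powers _ n) 0 0 = map_poly intr F]) ->
  exists (X1 Y1 : 'M[int]_(n, n.+1)) (X2 Y2 : 'M[int]_n.+1),
    [/\ X2^T = X2, Y2^T = Y2 & forall p, prime p ->
        block_equiv (toZp p X1) (toZp p Y1) (A1 p) (B1 p)
                    (toZp p X2) (toZp p Y2) (A2 p) (B2 p)].
Proof.
move=> F_size D0 loc.
have [|g0 [V0 [det_g0 V0_neq0 gV]]] := @local_lattice_pair n D g V D0.
  by move=> p /loc[].
have g0_neq0 : \det g0 != 0 by rewrite det_g0.
have d1 m : \det (1%:M : 'M[int]_m) != 0 by rewrite det1; exact: oner_neq0.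
have padE p := @map_pad int (padic p) intr n.
have detV p : prime p -> GRing.lreg (\det (toZp p V0)) by move/padic_det_lreg; apply.
have detVT p : prime p -> GRing.lreg (\det (toZp p V0^T)).
  by move=> p_pr; apply: padic_det_lreg; rewrite ?det_tr.
(* g0 *m P int *m V0^-1 is integral, because it is so at each prime. *)
have off (P : forall R : comNzRingType, 'M[R]_(n, n.+1)) (C : forall p, 'M[padic p]_(n, n.+1)) :
    (forall p, toZp p (P int) = P (padic p)) ->
    (forall p, prime p -> C p *m V p = g p *m P (padic p)) ->
    exists X : 'M[int]_(n, n.+1), X *m V0 = g0 *m P int.
  move=> P_map CP.
  have [p p_pr|X XV] := @solve_local _ _ 1%:M V0 (g0 *m P int) (d1 _) V0_neq0.
    have [k [k' [m [m' [gk kk' Vm mm' _]]]]] := gV p p_pr.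
    exists (k' *m C p *m m); rewrite map_mx1 mul1mx -mulmxA -Vm -mulmxA CP // gk.
    by rewrite !mulmxA (mulmx1C kk') mul1mx map_mxM P_map.
  by exists X; rewrite -XV mul1mx.
have [X1 X1V] := off (fun R => rpad R n) A1 (fun p => (padE p).1)
  (fun p p_pr => let: And5 _ (conj e _) _ _ _ := loc p p_pr in e).
have [Y1 Y1V] := off (fun R => lpad R n) B1 (fun p => (padE p).2)
  (fun p p_pr => let: And5 _ (conj _ e) _ _ _ := loc p p_pr in e).
have [SA [SB [SAs SBs SF]]] := diag_pencil_form F_size.
have W_ex p : exists W : 'M[padic p]_(n.+1, n), prime p ->
    (V p)^T *m A2 p *m V p = toZp p SA + (W *m rpad _ n + (W *m rpad _ n)^T) /\
    (V p)^T *m B2 p *m V p = toZp p SB + (W *m lpad _ n + (W *m lpad _ n)^T).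
  case: (boolP (prime p)) => [p_pr|_]; last by exists 0.
  have [[A2s B2s] _ _ _ FE] := loc p p_pr.
  pose QA := (V p)^T *m A2 p *m V p - toZp p SA.
  pose QB := (V p)^T *m B2 p *m V p - toZp p SB.
  have QAs : QA^T = QA by rewrite /QA linearB /= sqr_tr_sym // map_trmx SAs.
  have QBs : QB^T = QB by rewrite /QB linearB /= sqr_tr_sym // map_trmx SBs.
  have [|W [WA WB]] := symmetric_pencil_sol QAs QBs.
    rewrite -/(pencil QA QB) /QA /QB pencilB mulmxBr mulmxBl mxE FE.
    by rewrite mxE -map_quad_powers SF subrr.
  by exists W; rewrite -WA -WB /QA /QB [in RHS]addrC subrK addrC subrK.
pose W p := sval (cid (W_ex p)).
have WP p : prime p ->
    (V p)^T *m A2 p *m V p = toZp p SA + (W p *m rpad _ n + (W p *m rpad _ n)^T) /\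
    (V p)^T *m B2 p *m V p = toZp p SB + (W p *m lpad _ n + (W p *m lpad _ n)^T).
  exact: svalP (cid (W_ex p)).
have dd0 : \det V0 * \det g0 != 0 by rewrite mulf_neq0.
have [W0 W0P] := crt_mx W dd0.
(* y is chosen so that V0^T y g0 is the error of the approximation. *)
have yP p : prime p -> exists y, toZp p W0 = W p + toZp p V0^T *m y *m toZp p g0.
  move=> /W0P[Y ->]; exists (toZp p (\adj V0^T) *m Y *m toZp p (\adj g0)).
  congr (_ + _); rewrite !mulmxA -map_mxM mul_mx_adj -!mulmxA -map_mxM mul_adj_mx.
  rewrite !map_scalar_mx mul_scalar_mx mul_mx_scalar scalerA det_tr.
  by rewrite intrM mulrC.
have diag (P : forall R : comNzRingType, 'M[R]_(n, n.+1)) (X : 'M[int]_(n, n.+1))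
    (S : 'M[int]_n.+1) (C : forall p, 'M[padic p]_n.+1) :
    (forall p, toZp p (P int) = P (padic p)) -> X *m V0 = g0 *m P int -> S^T = S ->
    (forall p, prime p -> (V p)^T *m C p *m V p =
       toZp p S + (W p *m P _ + (W p *m P _)^T)) ->
    exists2 X2 : 'M[int]_n.+1, X2^T = X2 &
      V0^T *m X2 *m V0 = S + (W0 *m P int + (W0 *m P int)^T).
  move=> P_map XV Ss CW; set S' := S + _.
  have V0T0 : \det V0^T != 0 by rewrite det_tr.
  have [p p_pr|X2 X2E] := @solve_local _ _ V0^T V0 S' V0T0 V0_neq0.
    have [k [k' [m [m' [_ _ Vm _ _]]]]] := gV p p_pr; have [y yE] := yP p p_pr.
    exists (m^T *m C p *m m + (y *m toZp p X + (y *m toZp p X)^T)).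
    rewrite -map_trmx.
    rewrite (@diag_block_eq _ _ (toZp p V0) (V p) m (C p) (toZp p S) (toZp p X)
      (P _) (toZp p g0) (W p) (toZp p W0) y Vm _ (CW p p_pr) _) //.
    - by rewrite /S' !map_mxD -map_trmx !map_mxM P_map.
    - by rewrite -map_mxM XV map_mxM P_map.
    by rewrite map_trmx.
  exists X2 => //; apply: (mulmx_det_injl (mulfI V0T0)).
  apply: (mulmx_det_inj (mulfI V0_neq0)).
  have -> : V0^T *m X2^T *m V0 = (V0^T *m X2 *m V0)^T.
    by rewrite !trmx_mul trmxK mulmxA.
  by rewrite X2E /S' [LHS]linearD [X in _ + X]linearD /= trmxK Ss [X in _ + X]addrC.
have [X2 X2s X2E] := diag (fun R => rpad R n) X1 SA A2 (fun p => (padE p).1) X1V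
  SAs (fun p p_pr => (WP p p_pr).1).
have [Y2 Y2s Y2E] := diag (fun R => lpad R n) Y1 SB B2 (fun p => (padE p).2) Y1V
  SBs (fun p p_pr => (WP p p_pr).2).
exists X1, Y1, X2, Y2; split=> // p p_pr.
have [k [k' [m [m' [gk kk' Vm mm' det_km]]]]] := gV p p_pr.
have [y yE] := yP p p_pr; rewrite -map_trmx in yE.
have [_ [A1V B1V] _ _ _] := loc p p_pr; have [WA WB] := WP p p_pr.
have X1V' : toZp p X1 *m toZp p V0 = toZp p g0 *m rpad _ n.
  by rewrite -map_mxM X1V map_mxM padE.
have Y1V' : toZp p Y1 *m toZp p V0 = toZp p g0 *m lpad _ n.
  by rewrite -map_mxM Y1V map_mxM padE.
have off_eq (C X P : 'M[padic p]_(n, n.+1)) : C *m V p = g p *m P ->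
    X *m toZp p V0 = toZp p g0 *m P -> C = act_off k m'^T X.
  move=> CV XV; rewrite /act_off trmxK -[LHS]mulmx1 -mm' mulmxA; congr (_ *m _).
  by apply: (mulmx_det_inj (detV p p_pr)); rewrite -!mulmxA -Vm XV CV gk mulmxA.
exists k, m'^T, (- (m'^T *m y)); split.
- by rewrite det_tr det_km -det_mulmx mm' det1.
- by split; [apply: off_eq A1V X1V' | apply: off_eq B1V Y1V'].
split.
  apply: (diag_block_local Vm X1V' WA yE (detV p p_pr) mm').
  by rewrite map_trmx -!map_mxM X2E !map_mxD -map_trmx map_mxM padE.
apply: (diag_block_local Vm Y1V' WB yE (detV p p_pr) mm').
by rewrite map_trmx -!map_mxM Y2E !map_mxD -map_trmx map_mxM padE.
Qed.

(** * Dehomogenization *)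

Section Dehomogenization.
Variable R : comNzRingType.

Definition dehom : {mpoly R[2]} -> {poly R} :=
  mmap (@polyC R) (fun i : 'I_2 => if i == 0 then 1 else 'X).

HB.instance Definition _ := GRing.RMorphism.on dehom.

Lemma dehom_coef d (f : {mpoly R[2]}) i : f \is d.-homog ->
  (dehom f)`_i = if (i <= d)%N then form_coef d f i else 0.
Proof.
move=> f_hom; rewrite /dehom /mmap coef_sum.
have mE m : (mmap1 (fun i : 'I_2 => if i == 0 then 1 else 'X) m : {poly R}) = 'X^(m 1%R).
  rewrite /mmap1 !big_ord_recl big_ord0 /= expr1n mul1r mulr1.
  by congr ('X^(m _)); apply: val_inj.
under eq_bigr => m _ do rewrite mE coefCM coefXn.
pose mon := (U_(0%R : 'I_2) *+ (d - i) + U_(1%R : 'I_2) *+ i)%MM.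
have mon0 : mon 0%R = (d - i)%N by rewrite mnmDE !mulmnE !mnmE /= mul1n addn0.
have mon1 : mon 1%R = i by rewrite mnmDE !mulmnE !mnmE /= mul1n.
have f_deg m : m \in msupp f -> (m 0%R + m 1%R = d)%N.
  move=> m_f; have <- : mdeg m = d := dhomogP _ _ _ f_hom m m_f.
  rewrite mdegE !big_ord_recl big_ord0 addn0.
  by congr (_ + m _)%N; apply: val_inj.
have term m : m \in msupp f -> m != mon -> f@_m * (i == m 1%R)%:R = 0.
  move=> /f_deg m_d m_mon; case: eqP => [mi|]; last by rewrite mulr0.
  case/eqP: m_mon; apply/mnmP => j; case: (unliftP 0 j) => [j' ->|->].
    by rewrite (_ : lift 0 j' = 1) ?mon1 //; apply: val_inj; rewrite ord1.
  by rewrite mon0 mi -m_d addnK.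
case: leqP => [le_id|lt_di]; last first.
  rewrite big_seq big1 // => m m_f; case: eqP => [mi|]; last by rewrite mulr0.
  by move: lt_di; rewrite mi -(f_deg m m_f) ltnNge leq_addl.
rewrite /form_coef -/mon; case: (boolP (mon \in msupp f)) => [mon_f|mon_f].
  rewrite (big_rem mon) //= mon1 eqxx mulr1 big_seq big1 ?addr0 // => m.
  rewrite mem_rem_uniq ?msupp_uniq // inE => /andP[m_mon m_f]; exact: term.
rewrite (memN_msupp_eq0 mon_f) big_seq big1 // => m m_f; apply: term => //.
by apply: contraNneq mon_f => <-.
Qed.

Lemma dehom_inv_form n (AB : 'M[R]_(n.*2.+1) * 'M[R]_(n.*2.+1)) :
  dehom (inv_form AB) = (-1) ^+ n * \det (pencil AB.1 AB.2).
Proof.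
rewrite /inv_form rmorphM rmorphXn rmorphN1 -det_map_mx; congr (_ * \det _).
apply/matrixP => i j; rewrite !mxE rmorphB !rmorphM /=.
have dC c : dehom c%:MP = c%:P by rewrite /dehom mmapC.
have dX k : dehom 'X_k = if k == 0 then 1 else 'X by rewrite /dehom mmapX mmap1U.
by rewrite !dC !dX /= mul1r.
Qed.

End Dehomogenization.

Lemma dehom_form_of_int (R : comNzRingType) (f : {mpoly int[2]}) d :
  f \is d.-homog -> dehom (form_of_int R f) = map_poly intr (dehom f).
Proof.
move=> f_hom.
have fR_hom : form_of_int R f \is d.-homog.
  apply/dhomogP => m; rewrite mcoeff_msupp mcoeff_map_mpoly => m_f.
  apply: (dhomogP _ _ _ f_hom); rewrite mcoeff_msupp.
  by apply: contraNneq m_f => ->.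
apply/polyP => i; rewrite coef_map /= (dehom_coef _ fR_hom) (dehom_coef _ f_hom).
by case: ifP => // _; rewrite /form_coef mcoeff_map_mpoly.
Qed.

(** At x = 1, y = X, the derivative of f in y becomes F', and the one in x
    becomes (2n+1) F - X F' by Euler's identity. *)
Lemma form_resultant_dehom n (f : {mpoly int[2]}) : f \is n.*2.+1.-homog ->
  let F := dehom f in
  form_resultant n.*2 (mderiv 0 f) (mderiv 1 f) =
  \det (col_mx (sylvester_half n.*2 (F *+ n.*2.+1 - 'X * F^`()))
               (sylvester_half n.*2 F^`())).
Proof.
move=> f_hom F; rewrite /form_resultant; congr (\det (col_mx _ _)).
  apply/matrixP => i j; rewrite !mxE; case: ifP => // /andP[le_ij le_ji].
  have {le_ji} le_d : (j - i <= n.*2)%N by rewrite leq_subLR.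
  move: (j - i)%N le_d => k le_kn; rewrite coefB coefMn coefXM /form_coef mcoeff_deriv.
  rewrite mnmDE !mulmnE !mnmE /= mul1n addn0.
  have -> : (U_(0%R : 'I_2) *+ (n.*2 - k) + U_(1%R : 'I_2) *+ k + U_(0%R : 'I_2) =
             U_(0%R : 'I_2) *+ (n.*2.+1 - k) + U_(1%R : 'I_2) *+ k)%MM.
    by rewrite subSn // mulmSr -!addmA [(U_(_) *+ k + _)%MM]addmC.
  have -> : f@_(U_(0%R : 'I_2) *+ (n.*2.+1 - k) + U_(1%R : 'I_2) *+ k) = F`_k.
    by rewrite (dehom_coef _ f_hom) leqW.
  rewrite -subSn // mulrnBr ?leqW //; congr (_ - _).
  by case: (k) => [|k'] //=; rewrite coef_deriv.
apply/matrixP => i j; rewrite !mxE; case: ifP => // /andP[le_ij le_ji].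
have {le_ji} le_d : (j - i <= n.*2)%N by rewrite leq_subLR.
move: (j - i)%N le_d => k le_kn; rewrite coef_deriv (dehom_coef _ f_hom) ltnS le_kn.
rewrite /form_coef mcoeff_deriv mnmDE !mulmnE !mnmE /= mul1n.
by rewrite -addmA -mulmSr subSS.
Qed.

(** * Block decomposition of the group and the representation *)

Lemma double_split n : n.*2.+1 = (n + n.+1)%N.
Proof. by rewrite addnS addnn. Qed.

Section Blocks.

Definition to_blocks (R : Type) n (X : 'M[R]_(n.*2.+1)) : 'M[R]_(n + n.+1) :=
  castmx (double_split n, double_split n) X.

Definition of_blocks (R : Type) n (X : 'M[R]_(n + n.+1)) : 'M[R]_(n.*2.+1) :=
  castmx (esym (double_split n), esym (double_split n)) X.

Lemma to_blocksK (R : Type) n : cancel (@to_blocks R n) (@of_blocks R n).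
Proof. exact: castmxK. Qed.

Lemma of_blocksK (R : Type) n : cancel (@of_blocks R n) (@to_blocks R n).
Proof. exact: castmxKV. Qed.

Lemma map_to_blocks (R S : Type) (f : R -> S) n (X : 'M[R]_(n.*2.+1)) :
  map_mx f (to_blocks X) = to_blocks (map_mx f X).
Proof. exact: map_castmx. Qed.

Lemma to_blocks_tr (R : Type) n (X : 'M[R]_(n.*2.+1)) :
  to_blocks X^T = (to_blocks X)^T.
Proof. by rewrite /to_blocks trmx_cast. Qed.

Variables (R : comNzRingType) (n : nat).
Implicit Types X Y g : 'M[R]_(n.*2.+1).

Lemma castmxM m k (e : m = k) (X Y : 'M[R]_m) :
  castmx (e, e) (X *m Y) = castmx (e, e) X *m castmx (e, e) Y.
Proof. by case: k / e; rewrite !castmx_id. Qed.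

Lemma det_castmx m k (e : m = k) (X : 'M[R]_m) : \det (castmx (e, e) X) = \det X.
Proof. by case: k / e; rewrite castmx_id. Qed.

Lemma to_blocksM X Y : to_blocks (X *m Y) = to_blocks X *m to_blocks Y.
Proof. exact: castmxM. Qed.

Lemma det_to_blocks X : \det (to_blocks X) = \det X.
Proof. exact: det_castmx. Qed.

Lemma to_blocksE X (i j : 'I_(n + n.+1)) :
  to_blocks X i j = X (cast_ord (esym (double_split n)) i) (cast_ord (esym (double_split n)) j).
Proof. exact: castmxE. Qed.

Definition offdiag X : 'M[R]_(n, n.+1) := ursubmx (to_blocks X).
Definition diagonal X : 'M[R]_n.+1 := drsubmx (to_blocks X).

Definition W0_mx X : Prop :=
  X^T = X /\ forall i j : 'I_(n.*2.+1), (i < n)%N -> (j < n)%N -> X i j = 0.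

Lemma inW0P (AB : 'M[R]_(n.*2.+1) * 'M[R]_(n.*2.+1)) :
  inW0 AB <-> W0_mx AB.1 /\ W0_mx AB.2.
Proof.
split=> [[[As Bs] AB0]|[[As A0] [Bs B0]]].
  by split; split=> // i j i_n j_n; have [] := AB0 i j i_n j_n.
by split=> // i j i_n j_n; rewrite A0 ?B0.
Qed.

Lemma W0_blocks X : W0_mx X ->
  to_blocks X = bordered (offdiag X) (diagonal X) /\ (diagonal X)^T = diagonal X.
Proof.
case=> Xs X0; have Xbs : (to_blocks X)^T = to_blocks X by rewrite -to_blocks_tr Xs.
split; last by rewrite /diagonal trmx_drsub Xbs.
rewrite -[LHS]submxK /bordered; congr block_mx; last first.
  by rewrite /offdiag trmx_ursub Xbs.
by apply/matrixP => i j; rewrite [LHS]mxE [LHS]mxE [RHS]mxE to_blocksE X0 /=.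
Qed.

Lemma W0_of_blocks (P : 'M[R]_(n, n.+1)) (Q : 'M[R]_n.+1) : Q^T = Q ->
  let X := of_blocks (bordered P Q) in
  [/\ W0_mx X, offdiag X = P & diagonal X = Q].
Proof.
move=> Qs X; rewrite /offdiag /diagonal /X of_blocksK block_mxKur block_mxKdr.
split=> //; split.
  rewrite /of_blocks trmx_cast /=; congr castmx.
  by rewrite /bordered tr_block_mx trmx0 trmxK Qs.
move=> i j i_n j_n; rewrite castmxE /=.
have -> : cast_ord (esym (esym (double_split n))) i = lshift n.+1 (Ordinal i_n) by apply: val_inj.
have -> : cast_ord (esym (esym (double_split n))) j = lshift n.+1 (Ordinal j_n) by apply: val_inj.
by rewrite block_mxEul mxE.
Qed.

Lemma inG_blocks g : inG g <->
  exists k1 k2 w, to_blocks g = block_mx k1 0 w k2 /\ \det k1 * \det k2 = 1.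
Proof.
split=> [[det_g g0]|[k1 [k2 [w [gE det_k]]]]].
  have ur0 : ursubmx (to_blocks g) = 0.
    apply/matrixP => i j; rewrite [LHS]mxE [LHS]mxE [RHS]mxE to_blocksE g0 //=.
    exact: leq_addr.
  exists (ulsubmx (to_blocks g)), (drsubmx (to_blocks g)), (dlsubmx (to_blocks g)).
  have gE : to_blocks g = block_mx (ulsubmx (to_blocks g)) 0
      (dlsubmx (to_blocks g)) (drsubmx (to_blocks g)) by rewrite -ur0 submxK.
  by split=> //; rewrite -(@det_lblock _ n n.+1 _ (dlsubmx (to_blocks g))) -gE det_to_blocks.
split; first by rewrite /inSL -det_to_blocks gE det_lblock.
move=> i j i_n n_j; rewrite -[g]to_blocksK gE castmxE /=.
have -> : cast_ord (esym (esym (double_split n))) i = lshift n.+1 (Ordinal i_n) by apply: val_inj.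
have j_n : (j - n < n.+1)%N by rewrite ltn_subLR // -double_split.
have -> : cast_ord (esym (esym (double_split n))) j = rshift n (Ordinal j_n).
  by apply: val_inj; rewrite /= subnKC.
by rewrite block_mxEur mxE.
Qed.

Lemma bordered_act (k1 : 'M[R]_n) (k2 Q : 'M[R]_n.+1) (w : 'M_(n.+1, n)) (P : 'M[R]_(n, n.+1)) :
  block_mx k1 0 w k2 *m bordered P Q *m (block_mx k1 0 w k2)^T =
  bordered (act_off k1 k2 P) (act_diag k2 w P Q).
Proof.
rewrite /bordered tr_block_mx trmx0 !mulmx_block.
rewrite !(mulmx0, mul0mx, addr0, add0r) mulmxDl; congr block_mx.
  by rewrite /act_off !trmx_mul trmxK mulmxA.
by rewrite /act_diag addrC; congr (_ + _); rewrite addrC.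
Qed.

Lemma bordered_inj (P P' : 'M[R]_(n, n.+1)) (Q Q' : 'M[R]_n.+1) :
  bordered P Q = bordered P' Q' -> P = P' /\ Q = Q'.
Proof. by move/eq_block_mx => [_ -> _ ->]. Qed.

Lemma G_equiv_blocks (AB CD : 'M[R]_(n.*2.+1) * 'M[R]_(n.*2.+1)) :
    inW0 AB -> inW0 CD ->
  G_equiv AB CD <->
  block_equiv (offdiag AB.1) (offdiag AB.2) (offdiag CD.1) (offdiag CD.2)
    (diagonal AB.1) (diagonal AB.2) (diagonal CD.1) (diagonal CD.2).
Proof.
move=> /inW0P[/W0_blocks[A_ _] /W0_blocks[B_ _]] /inW0P[/W0_blocks[C_ _] /W0_blocks[D_ _]].
split=> [[g [/inG_blocks[k1 [k2 [w [gE det_k]]]] gAB]]|].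
  move: CD gAB C_ D_ => [C D] [<- <-] /=; rewrite !to_blocksM to_blocks_tr gE A_ B_.
  rewrite !bordered_act => /bordered_inj[eC1 eC2] /bordered_inj[eD1 eD2].
  by exists k1, k2, w.
move=> [k1 [k2 [w [det_k [eC1 eD1] [eC2 eD2]]]]].
exists (of_blocks (block_mx k1 0 w k2)); split.
  by apply/inG_blocks; exists k1, k2, w; rewrite of_blocksK.
case: CD C_ D_ eC1 eC2 eD1 eD2 => C D /= C_ D_ eC1 eC2 eD1 eD2; congr pair;
  apply: (can_inj (@to_blocksK R n)); rewrite !to_blocksM to_blocks_tr of_blocksK.
  by rewrite A_ bordered_act C_ eC1 eC2.
by rewrite B_ bordered_act D_ eD1 eD2.
Qed.

Lemma inG_inv g : inG g -> exists2 h, inG h & h *m g = 1%:M.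
Proof.
move=> /inG_blocks[k1 [k2 [w [gE det_k]]]].
have k1K : (\det k2 *: \adj k1) *m k1 = 1%:M.
  by rewrite -scalemxAl mul_adj_mx scale_scalar_mx mulrC det_k.
have k2K : (\det k1 *: \adj k2) *m k2 = 1%:M.
  by rewrite -scalemxAl mul_adj_mx scale_scalar_mx det_k.
pose h1 := \det k2 *: \adj k1; pose h2 := \det k1 *: \adj k2.
exists (of_blocks (block_mx h1 0 (- (h2 *m w *m h1)) h2)).
  apply/inG_blocks; exists h1, h2, (- (h2 *m w *m h1)); rewrite of_blocksK.
  split=> //; have := congr1 determinant k1K; have := congr1 determinant k2K.
  rewrite !det_mulmx -/h1 -/h2 !det1 => e2 e1.
  by rewrite -[LHS]mulr1 -{1}det_k mulrACA e1 e2 mulr1.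
apply: (can_inj (@to_blocksK R n)); rewrite to_blocksM of_blocksK gE mulmx_block.
rewrite !(mulmx0, mul0mx, addr0, add0r) k1K k2K mulNmx -!mulmxA k1K mulmx1 addrC subrr.
rewrite -scalar_mx_block; apply: (can_inj (@of_blocksK R n)).
by rewrite to_blocksK; apply/matrixP => i j; rewrite castmxE !mxE.
Qed.

Lemma inG_mul g h : inG g -> inG h -> inG (g *m h).
Proof.
move=> /inG_blocks[k1 [k2 [w [gE det_k]]]] /inG_blocks[h1 [h2 [z [hE det_h]]]].
apply/inG_blocks; exists (k1 *m h1), (k2 *m h2), (w *m h1 + k2 *m z).
rewrite to_blocksM gE hE mulmx_block !(mulmx0, mul0mx, addr0, add0r).
by rewrite !det_mulmx mulrACA det_k det_h mulr1.
Qed.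

Lemma actM g h (AB : 'M[R]_(n.*2.+1) * 'M[R]_(n.*2.+1)) :
  act g (act h AB) = act (g *m h) AB.
Proof. by rewrite /act /= trmx_mul !mulmxA. Qed.

Lemma act1 (AB : 'M[R]_(n.*2.+1) * 'M[R]_(n.*2.+1)) : act 1%:M AB = AB.
Proof. by case: AB => A B; rewrite /act /= trmx1 !mul1mx !mulmx1. Qed.

Lemma G_equiv_trans_sym (AB AB' CD : 'M[R]_(n.*2.+1) * 'M[R]_(n.*2.+1)) :
  G_equiv AB CD -> G_equiv AB' CD -> G_equiv AB AB'.
Proof.
move=> [g [gG <-]] [g' [/inG_inv[h hG hg'] e]].
by exists (h *m g); split; [apply: inG_mul | rewrite -actM -e actM hg' act1].
Qed.

End Blocks.

(** * The local invariants of a form *)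

Lemma dehom_size (f : {mpoly int[2]}) d : f \is d.-homog -> (size (dehom f) <= d.+1)%N.
Proof.
move=> f_hom; apply/leq_sizeP => k d_k.
by rewrite (dehom_coef _ f_hom) leqNgt d_k.
Qed.

Lemma quad_form_powers (R : comNzRingType) n (A1 B1 : 'M[R]_(n, n.+1)) (A2 B2 : 'M[R]_n.+1) :
  let V := minors_mx A1 B1 in
  ((powers R n)^T *m pencil (V^T *m A2 *m V) (V^T *m B2 *m V) *m powers R n) 0 0
  = quad_form A1 B1 A2 B2.
Proof.
rewrite /quad_form minors_mxE; move: (minors_mx A1 B1) => V /=.
by rewrite pencilMr -!mulmxA pencilMl trmx_mul map_trmx !mulmxA.
Qed.

Lemma pencil_to_blocks (R : comNzRingType) n (A B : 'M[R]_(n.*2.+1)) :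
  to_blocks (pencil A B) = pencil (to_blocks A) (to_blocks B).
Proof. by apply/matrixP => i j; rewrite !mxE !to_blocksE !mxE. Qed.

Lemma pencil_bordered (R : comNzRingType) n (P P' : 'M[R]_(n, n.+1)) (Q Q' : 'M[R]_n.+1) :
  pencil (bordered P Q) (bordered P' Q') = bordered (pencil P P') (pencil Q Q').
Proof.
rewrite /pencil /bordered !map_block_mx scale_block_mx opp_block_mx add_block_mx.
by rewrite !map_mx0 scaler0 subr0 [(_ - _)^T]linearB /= [('X *: _)^T]linearZ /= !map_trmx.
Qed.

(** The pencil of a pair in W0 is a bordered matrix, so its determinant is the
    diagonal block evaluated on the minors of the off-diagonal one. *)
Lemma inv_form_quad_form (R : comNzRingType) n (f : {mpoly int[2]})
    (AB : 'M[R]_(n.*2.+1) * 'M[R]_(n.*2.+1)) :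
    f \is n.*2.+1.-homog -> inW0 AB -> inv_form AB = form_of_int R f ->
  quad_form (offdiag AB.1) (offdiag AB.2) (diagonal AB.1) (diagonal AB.2)
  = map_poly intr (dehom f).
Proof.
move=> f_hom /inW0P[/W0_blocks[A_ _] /W0_blocks[B_ _]] /(congr1 (@dehom R)).
rewrite dehom_inv_form (dehom_form_of_int _ f_hom) => <-.
rewrite -det_to_blocks pencil_to_blocks A_ B_ pencil_bordered det_bordered.
by rewrite mulrA -exprMn mulrNN mulr1 expr1n mul1r.
Qed.

Lemma map_sylvester_half (R : comNzRingType) d (p : {poly int}) :
  map_mx intr (sylvester_half d p) = sylvester_half d (map_poly (intr : int -> R) p).
Proof. by apply/matrixP => i j; rewrite !mxE; case: ifP => _; rewrite ?coef_map // rmorph0. Qed.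

Section LocalInvariants.
Variables (n : nat) (f : {mpoly int[2]}).
Hypothesis n_gt0 : (1 <= n)%N.
Hypothesis f_hom : f \is n.*2.+1.-homog.
Local Notation res := (form_resultant n.*2 (mderiv 0 f) (mderiv 1 f)).

Lemma minors_mx_dvd_resultant p (AB : 'M[padic p]_(n.*2.+1) * 'M[padic p]_(n.*2.+1)) :
    prime p -> res != 0 -> inW0 AB -> inv_form AB = form_of_int (padic p) f ->
  exists m u, u * \det (minors_mx (offdiag AB.1) (offdiag AB.2)) = res%:~R ^+ m.
Proof.
move=> p_pr res0 AB_W0 ABf.
have [/W0_blocks[_ A2s] /W0_blocks[_ B2s]] := (inW0P AB).1 AB_W0.
have FE := inv_form_quad_form f_hom AB_W0 ABf.
have := resultant_minors_mx (A1 := offdiag AB.1) (B1 := offdiag AB.2) A2s B2s n_gt0.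
rewrite /= FE => dvd.
have cE : res%:~R = \det (col_mx
    (sylvester_half n.*2 (map_poly intr (dehom f) *+ n.*2.+1 - 'X * (map_poly intr (dehom f))^`()))
    (sylvester_half n.*2 (map_poly intr (dehom f))^`())) :> padic p.
  rewrite (form_resultant_dehom f_hom) -det_map_mx map_col_mx !map_sylvester_half.
  by rewrite rmorphB rmorphM rmorphMn /= map_polyX deriv_map.
by rewrite cE; apply: dvd; rewrite -cE; apply: padic_intr_lreg.
Qed.

End LocalInvariants.

(** * Global pairs with given localizations *)

Lemma pair_of_int_inW0 (R : comNzRingType) n
    (AB : 'M[int]_(n.*2.+1) * 'M[int]_(n.*2.+1)) :
  inW0 AB -> inW0 (pair_of_int R AB).
Proof.
move=> /inW0P[[As A0] [Bs B0]]; apply/inW0P; split; split=> /=;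
  rewrite ?map_trmx ?As ?Bs // => i j i_n j_n; rewrite mxE ?A0 ?B0 //; exact: rmorph0.
Qed.

Lemma block_equiv_pair_of_int (R : comNzRingType) n
    (AB : 'M[int]_(n.*2.+1) * 'M[int]_(n.*2.+1)) (CD : 'M[R]_(n.*2.+1) * 'M[R]_(n.*2.+1)) :
    inW0 AB -> inW0 CD ->
  G_equiv (pair_of_int R AB) CD <->
  block_equiv (map_mx intr (offdiag AB.1)) (map_mx intr (offdiag AB.2))
    (offdiag CD.1) (offdiag CD.2)
    (map_mx intr (diagonal AB.1)) (map_mx intr (diagonal AB.2))
    (diagonal CD.1) (diagonal CD.2).
Proof.
move=> /(@pair_of_int_inW0 R) AB0 CD0; have := G_equiv_blocks AB0 CD0.
rewrite /offdiag /diagonal /= -!map_to_blocks.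
by rewrite !map_ursubmx !map_drsubmx.
Qed.

(** Equivalence multiplies the determinant of the coefficients of the minors by
    a unit. *)
Lemma minors_mx_equiv_neq0 n (AB : 'M[int]_(n.*2.+1) * 'M[int]_(n.*2.+1)) p
    (CD : 'M[padic p]_(n.*2.+1) * 'M[padic p]_(n.*2.+1)) :
    inW0 AB -> inW0 CD -> G_equiv (pair_of_int (padic p) AB) CD ->
    \det (minors_mx (offdiag CD.1) (offdiag CD.2)) != 0 ->
  \det (minors_mx (offdiag AB.1) (offdiag AB.2)) != 0.
Proof.
move=> AB0 CD0 /(block_equiv_pair_of_int AB0 CD0)[k1 [k2 [w [det_k [eA eB] _]]]].
have := minors_mx_equiv det_k eA eB; rewrite -map_minors_mx.
move: (minors_mx (offdiag CD.1) (offdiag CD.2)) => V'.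
move: (minors_mx (offdiag AB.1) (offdiag AB.2)) => V VE.
apply: contra_neq => V0; have := congr1 determinant VE.
rewrite det_mulmx det_tr det_map_mx V0 rmorph0 => /(congr1 ( *%R (\det k1))).
by rewrite mulr0 mulrA det_k mul1r.
Qed.

Lemma G_equiv_local_global n (AB AB' : 'M[int]_(n.*2.+1) * 'M[int]_(n.*2.+1)) :
    inW0 AB -> inW0 AB' ->
    \det (minors_mx (offdiag AB.1) (offdiag AB.2)) != 0 ->
    \det (minors_mx (offdiag AB'.1) (offdiag AB'.2)) != 0 ->
    (forall p, prime p -> G_equiv (pair_of_int (padic p) AB) (pair_of_int (padic p) AB')) ->
  G_equiv AB AB'.
Proof.
move=> AB0 AB'0 V0 V'0 loc; apply/(G_equiv_blocks AB0 AB'0).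
have [/W0_blocks[_ A2s] /W0_blocks[_ B2s]] := (inW0P AB).1 AB0.
have [/W0_blocks[_ A2's] /W0_blocks[_ B2's]] := (inW0P AB').1 AB'0.
have [g [gA gB det_g]] := normal_form (mulfI V0).
have [g' [gA' gB' det_g']] := normal_form (mulfI V'0).
have g0 : \det g != 0 by rewrite det_g; exact: V0.
apply: (block_equiv_local_global A2s B2s A2's B2's gA gB gA' gB' g0 V0 V'0).
move=> p p_pr.
have /(block_equiv_pair_of_int AB0 (pair_of_int_inW0 _ AB'0)) := loc p p_pr.
have map_off X : offdiag (toZp p X) = toZp p (offdiag X).
  by rewrite /offdiag -map_to_blocks map_ursubmx.
have map_diag X : diagonal (toZp p X) = toZp p (diagonal X).
  by rewrite /diagonal -map_to_blocks map_drsubmx.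
rewrite /= !map_off !map_diag => -[k1 [k2 [w [det_k [eA eB] e2]]]].
exists k1, k2, w; split=> //.
have mapV := @map_minors_mx int n (padic p) intr.
exact: etrans (congr1 (mulmx k2^T) (mapV _ _))
  (etrans (minors_mx_equiv det_k eA eB) (esym (mapV _ _))).
Qed.

Theorem theorem1p3 (n : nat) (hn : (1 <= n)%N) (f : {mpoly int[2]})
    (hf : binary_form n.*2.+1 f) (hdisc : form_disc n.*2.+1 f != 0)
    (ABp : forall p : nat, 'M[padic p]_(n.*2.+1) * 'M[padic p]_(n.*2.+1))
    (hABp : forall p : nat, prime p ->
       inW0 (ABp p) /\ inv_form (ABp p) = form_of_int (padic p) f) :
  exists AB : 'M[int]_(n.*2.+1) * 'M[int]_(n.*2.+1),
    [/\ inW0 AB,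
        (forall p : nat, prime p -> G_equiv (pair_of_int (padic p) AB) (ABp p))
      & (forall AB' : 'M[int]_(n.*2.+1) * 'M[int]_(n.*2.+1),
           inW0 AB' ->
           (forall p : nat, prime p ->
              G_equiv (pair_of_int (padic p) AB') (ABp p)) ->
           G_equiv AB AB')].
Proof.
set res := form_resultant n.*2 (mderiv 0 f) (mderiv 1 f).
have res0 : res != 0.
  apply: contra_neq hdisc => res0.
  by rewrite /form_disc -/res res0 rmorph0 mulr0 mul0r.
pose V p := minors_mx (offdiag (ABp p).1) (offdiag (ABp p).2).
have [D D0 VD] : exists2 D : int, D != 0 &
    forall p, prime p -> exists u, u * \det (V p) = D%:~R.
  apply: (padic_dvd_pow (q := fun p => \det (V p)) res0) => p p_pr.
  have [AB0 ABf] := hABp p p_pr.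
  exact: (minors_mx_dvd_resultant hn hf p_pr res0 AB0 ABf).
have V_neq0 p : prime p -> \det (V p) != 0.
  move=> p_pr; apply: contra_neq D0 => V0; apply: (padic_intr_inj p_pr).
  by have [u <-] := VD p p_pr; rewrite V0 mulr0.
have V_reg p : prime p -> GRing.lreg (\det (V p)).
  move=> p_pr; have [u uV] := VD p p_pr.
  by apply: (@lregW _ u); rewrite uV; apply: padic_intr_lreg.
(* Totalized over all p, so that a family of normal forms can be chosen. *)
have g_ex p : exists g : 'M[padic p]_n, prime p ->
    [/\ offdiag (ABp p).1 *m V p = g *m rpad _ n,
        offdiag (ABp p).2 *m V p = g *m lpad _ n & \det g = \det (V p)].
  case: (boolP (prime p)) => [p_pr|_]; last by exists 0.
  by have [g gP] := normal_form (V_reg p p_pr); exists g.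
pose g p := sval (cid (g_ex p)).
have gP p : prime p ->
    [/\ offdiag (ABp p).1 *m V p = g p *m rpad _ n,
        offdiag (ABp p).2 *m V p = g p *m lpad _ n & \det (g p) = \det (V p)].
  exact: svalP (cid (g_ex p)).
have F_size : (size (dehom f) <= n.+1.*2)%N by exact: dehom_size hf.
have [|X1 [Y1 [X2 [Y2 [X2s Y2s loc]]]]] := block_exists
  (A1 := fun p => offdiag (ABp p).1) (B1 := fun p => offdiag (ABp p).2)
  (A2 := fun p => diagonal (ABp p).1) (B2 := fun p => diagonal (ABp p).2)
  (V := V) (g := g) F_size D0.
  move=> p p_pr; have [AB0 ABf] := hABp p p_pr.
  have [/W0_blocks[_ A2s] /W0_blocks[_ B2s]] := (inW0P (ABp p)).1 AB0.
  have [gA gB det_g] := gP p p_pr; split=> //; first exact: VD.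
  by rewrite -(inv_form_quad_form hf AB0 ABf); apply: quad_form_powers.
have [X0 X1E X2E] := W0_of_blocks X1 X2s; have [Y0 Y1E Y2E] := W0_of_blocks Y1 Y2s.
exists (of_blocks (bordered X1 X2), of_blocks (bordered Y1 Y2)).
have AB0 : inW0 (of_blocks (bordered X1 X2), of_blocks (bordered Y1 Y2)).
  by apply/inW0P.
have AB_loc p : prime p -> G_equiv (pair_of_int (padic p)
    (of_blocks (bordered X1 X2), of_blocks (bordered Y1 Y2))) (ABp p).
  move=> p_pr; have [ABp0 _] := hABp p p_pr.
  apply/(block_equiv_pair_of_int AB0 ABp0); rewrite /= X1E X2E Y1E Y2E.
  exact: loc.
split=> // AB' AB'0 AB'_loc.
(* Both determinants can be seen to be nonzero at any one prime. *)
have [AB20 _] := hABp 2 isT.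
apply: (G_equiv_local_global AB0 AB'0).
- exact: (minors_mx_equiv_neq0 AB0 AB20 (AB_loc 2 isT) (V_neq0 2 isT)).
- exact: (minors_mx_equiv_neq0 AB'0 AB20 (AB'_loc 2 isT) (V_neq0 2 isT)).
move=> p p_pr; exact: G_equiv_trans_sym (AB_loc p p_pr) (AB'_loc p p_pr).
Qed.
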